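(* Let $n \geq 0$. For every $\emptyset^{(n+1)}$-computable set $A \subseteq \omega$ and every set $P$ of PA degree over $\emptyset^{(n+1)}$, there is an infinite set $G$ with $G \subseteq A$ or $G \subseteq \omega\setminus A$ such that $G^{(n+1)} \leq_T P$.
   Context: $P$ is of PA degree over $X$ if $P$ computes a path through every infinite $X$-computable binary tree (equivalently, a completion of Peano arithmetic relative to $X$). *)

(* Defs.v *)
From Stdlib Require Import Arith List Cantor.
Import ListNotations.

(* Sets of naturals are predicates on nat (the jump is not decidable). *)
Definition set := nat -> Prop.

Definition emptyset : set := fun _ => False.

Definition Infinite (X : set) : Prop := forall m, exists k, m <= k /\ X k.

Inductive code : Type :=
| CZero   : code
| CSucc   : code
| CProj   : nat -> code
| COracle : code
| CComp   : code -> list code -> code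
| CPrec   : code -> code -> code
| CMu     : code -> code.

Section Eval.
Variable X : set.

Inductive eval : code -> list nat -> nat -> Prop :=
| e_zero xs : eval CZero xs 0
| e_succ xs : eval CSucc xs (S (hd 0 xs))
| e_proj i xs : eval (CProj i) xs (nth i xs 0)
| e_orac1 xs : X (hd 0 xs) -> eval COracle xs 1
| e_orac0 xs : ~ X (hd 0 xs) -> eval COracle xs 0
| e_comp f gs xs ys v : evals gs xs ys -> eval f ys v -> eval (CComp f gs) xs v
| e_prec0 f g xs v : eval f xs v -> eval (CPrec f g) (0 :: xs) v
| e_precS f g y xs w v :
    eval (CPrec f g) (y :: xs) w -> eval g (y :: w :: xs) v ->
    eval (CPrec f g) (S y :: xs) v
| e_mu f xs y :
    eval f (y :: xs) 0 ->
    (forall z, z < y -> exists w, eval f (z :: xs) (S w)) ->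
    eval (CMu f) xs y
with evals : list code -> list nat -> list nat -> Prop :=
| es_nil xs : evals [] xs []
| es_cons g gs xs v vs : eval g xs v -> evals gs xs vs -> evals (g :: gs) xs (v :: vs).
End Eval.

Fixpoint decode_f (fuel n : nat) {struct fuel} : code :=
  match fuel with
  | 0 => CZero
  | S fu =>
      let (tag, r) := of_nat n in
      match tag with
      | 0 => CZero
      | 1 => CSucc
      | 2 => CProj r
      | 3 => COracle
      | 4 => let (a, b) := of_nat r in CComp (decode_f fu a) (decodes_f fu b)
      | 5 => let (a, b) := of_nat r in CPrec (decode_f fu a) (decode_f fu b)
      | 6 => CMu (decode_f fu r)
      | _ => CZero
      end
  end
with decodes_f (fuel m : nat) {struct fuel} : list code :=
  match fuel with
  | 0 => []
  | S fu =>
      match m with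
      | 0 => []
      | S m' => let (a, b) := of_nat m' in decode_f fu a :: decodes_f fu b
      end
  end.

Definition decode (e : nat) : code := decode_f (S e) e.

Definition Treducible (A X : set) : Prop :=
  exists c : code, forall n,
    (A n -> eval X c [n] 1) /\ (~ A n -> eval X c [n] 0).

Definition jump (X : set) : set := fun e => exists v, eval X (decode e) [e] v.

Fixpoint jumpn (k : nat) (X : set) : set :=
  match k with
  | 0 => X
  | S k' => jump (jumpn k' X)
  end.

(* bijective coding of finite binary strings 2^{<omega} into nat *)
Fixpoint code_str (s : list bool) : nat :=
  match s with
  | [] => 0
  | b :: t => 2 * code_str t + (if b then 2 else 1)
  end.

Definition IsTree (T : set) : Prop :=
  forall s t : list bool, T (code_str (s ++ t)) -> T (code_str s).

Definition init_seg (f : nat -> bool) (k : nat) : list bool := map f (seq 0 k).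

Definition IsPath (T : set) (f : nat -> bool) : Prop :=
  forall k, T (code_str (init_seg f k)).

Definition as_set (f : nat -> bool) : set := fun n => f n = true.

Definition PA_over (P X : set) : Prop :=
  forall T : set, IsTree T -> Infinite T -> Treducible T X ->
    exists f : nat -> bool, IsPath T f /\ Treducible (as_set f) P.

(* Main.v *)
Require Import Defs.
From Stdlib Require Import Arith List Cantor.
From Stdlib Require Import Lia Classical ClassicalEpsilon.
Import ListNotations.

(** Levels [m = 0, ..., n] carry a set [Z m], low over the [m]-th jump of the
    empty set, and a decreasing sequence [R m k] of sets generating an ultrafilter on a
    Scott set coded by a [W] low over [Z m]. The class [core (Z m) (R m)], cut out by
    the [Sigma^0_1(Z m)] open classes containing every [R m k], is partition regular
    because [W] codes a Scott set, and the choice of [R (m+1)] inside it makes the cores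
    decrease with [m]. The admissible choices of [R m] form a [Pi^0_1] class relative to
    the [(m+1)]-st jump; a low PA set chooses for [m < n], and [P] chooses at level [n].

    By partition regularity [A] or its complement is in the last core. A condition is
    a finite stem [p] with reservoir [A] intersected with all [R m k]. A
    [Sigma^0_(m+1)] formula is settled at [(p, k)] either negatively, when no extension
    of [p] inside [R m k] witnesses it, or positively by a witness. If no [k] settles it
    negatively, the extensions witnessing it form an open class containing every
    [R m k], hence containing the reservoir. So a [P]-computable search always succeeds,
    and the resulting [G] has its [(n+1)]-st jump computable in [P]. *)

(** The obstacle is the cost of the questions. Whether a stem has an extension inside [A] that
    witnesses a formula refers to [A], which is only known to [P], and asking whether a reservoir
    stays infinite costs further jumps. So the questions mention only the sets [R m k], and
    [level_open] answers every [Sigma^0_1(Z m)] question about them within [Z (m+1)]: each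
    quantifier of a formula costs one level, and the last one costs [P]. Membership in the core
    transfers the answers to [A]: a positive answer for all [k] yields an extension inside the
    reservoir, and a negative one for a single [k] is never revoked, because later conditions only
    shrink. The cores must decrease because one set [A] has to serve all levels at once. Lowness
    below the top is needed because the class of choices at level [m+1] speaks about the jump of
    [Z (m+1)], which must stay below the (m+2)-nd jump of the empty set. No class is formed above
    [P], so [P] itself may be arbitrary. *)

(** * Evaluation: induction principle and determinism *)

Section EvalInd.
Variables (X : set) (P : code -> list nat -> nat -> Prop)
  (P0 : list code -> list nat -> list nat -> Prop).
Hypothesis Hz : forall xs, P CZero xs 0.
Hypothesis Hs : forall xs, P CSucc xs (S (hd 0 xs)).
Hypothesis Hp : forall i xs, P (CProj i) xs (nth i xs 0).
Hypothesis Ho1 : forall xs, X (hd 0 xs) -> P COracle xs 1.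
Hypothesis Ho0 : forall xs, ~ X (hd 0 xs) -> P COracle xs 0.
Hypothesis Hc : forall f gs xs ys v,
  P0 gs xs ys -> P f ys v -> P (CComp f gs) xs v.
Hypothesis Hr0 : forall f g xs v, P f xs v -> P (CPrec f g) (0 :: xs) v.
Hypothesis HrS : forall f g y xs w v, P (CPrec f g) (y :: xs) w ->
  P g (y :: w :: xs) v -> P (CPrec f g) (S y :: xs) v.
Hypothesis Hm : forall f xs y, P f (y :: xs) 0 ->
  (forall z, z < y -> exists w, P f (z :: xs) (S w)) -> P (CMu f) xs y.
Hypothesis Hn : forall xs, P0 [] xs [].
Hypothesis Hcons : forall g gs xs v vs,
  P g xs v -> P0 gs xs vs -> P0 (g :: gs) xs (v :: vs).

(* The automatic scheme gives no induction hypothesis for the premises of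
   [e_mu] hidden under [exists]. *)
Fixpoint eval_strong_ind c xs v (h : eval X c xs v) {struct h} : P c xs v :=
  match h with
  | e_zero _ xs => Hz xs
  | e_succ _ xs => Hs xs
  | e_proj _ i xs => Hp i xs
  | e_orac1 _ xs h => Ho1 xs h
  | e_orac0 _ xs h => Ho0 xs h
  | e_comp _ f gs xs ys v h1 h2 =>
      Hc f gs xs ys v (evals_strong_ind _ _ _ h1) (eval_strong_ind _ _ _ h2)
  | e_prec0 _ f g xs v h => Hr0 f g xs v (eval_strong_ind _ _ _ h)
  | e_precS _ f g y xs w v h1 h2 =>
      HrS f g y xs w v (eval_strong_ind _ _ _ h1) (eval_strong_ind _ _ _ h2)
  | e_mu _ f xs y h1 h2 =>
      Hm f xs y (eval_strong_ind _ _ _ h1)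
        (fun z hz => match h2 z hz with
                     | ex_intro _ w hw => ex_intro _ w (eval_strong_ind _ _ _ hw)
                     end)
  end
with evals_strong_ind gs xs vs (h : evals X gs xs vs) {struct h} : P0 gs xs vs :=
  match h with
  | es_nil _ xs => Hn xs
  | es_cons _ g gs xs v vs h1 h2 =>
      Hcons g gs xs v vs (eval_strong_ind _ _ _ h1) (evals_strong_ind _ _ _ h2)
  end.
End EvalInd.

Lemma eval_det (X : set) c xs v : eval X c xs v ->
  forall v', eval X c xs v' -> v = v'.
Proof.
  revert c xs v.
  apply (eval_strong_ind X (fun c xs v => forall v', eval X c xs v' -> v = v')
           (fun gs xs vs => forall vs', evals X gs xs vs' -> vs = vs')).
  1-3: intros; match goal with H : eval _ _ _ _ |- _ => inversion H end; auto.
  1-2: intros xs H v' H'; inversion H'; tauto.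
  - intros f gs xs ys v H1 H2 v' H'; inversion H'; subst.
    apply H2. rewrite (H1 ys0); auto.
  - intros f g xs v H v' H'; inversion H'; subst; auto.
  - intros f g y xs w v H1 H2 v' H'; inversion H'; subst.
    rewrite (H1 w0) in H2; auto.
  - intros f xs y H1 H2 v' H'; inversion H'; subst.
    destruct (lt_eq_lt_dec y v') as [[l|l]|l]; auto.
    + match goal with K : forall z, z < v' -> _ |- _ =>
        destruct (K _ l) as [w Hw] end.
      specialize (H1 _ Hw); discriminate.
    + destruct (H2 _ l) as [w Hw].
      match goal with K : eval _ _ _ 0 |- _ => specialize (Hw _ K) end.
      discriminate.
  - intros xs vs' H; inversion H; auto.
  - intros g gs xs v vs H1 H2 vs' H'; inversion H'; subst. f_equal; auto.
Qed.

(** * Computable functions *)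

Definition comp (X : set) (f : nat -> nat) : Prop :=
  exists c, forall n, eval X c [n] (f n).

Notation dec X R := (Treducible R X) (only parsing).

Definition chi (R : nat -> Prop) (n : nat) : nat :=
  if excluded_middle_informative (R n) then 1 else 0.

Lemma chi_true R n : R n -> chi R n = 1.
Proof. unfold chi. destruct excluded_middle_informative; tauto. Qed.

Lemma chi_false R n : ~ R n -> chi R n = 0.
Proof. unfold chi. destruct excluded_middle_informative; tauto. Qed.

Lemma chi_spec R n : chi R n = 1 <-> R n.
Proof.
  destruct (classic (R n)) as [H|H].
  - rewrite chi_true; tauto.
  - rewrite chi_false; auto. split; [discriminate|tauto].
Qed.

Lemma dec_chi X R : dec X R <-> comp X (chi R).
Proof.
  split; intros [c H]; exists c; intros n.
  - destruct (classic (R n)) as [h|h].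
    + rewrite chi_true; auto; apply H; auto.
    + rewrite chi_false; auto; apply H; auto.
  - specialize (H n). split; intros h.
    + rewrite chi_true in H; auto.
    + rewrite chi_false in H; auto.
Qed.

Lemma comp_ext X f g : comp X f -> (forall n, f n = g n) -> comp X g.
Proof. intros [c H] E; exists c; intros n; rewrite <- E; auto. Qed.

Lemma dec_ext X (R R' : nat -> Prop) :
  dec X R -> (forall n, R n <-> R' n) -> dec X R'.
Proof.
  intros [c H] E; exists c; intros n; destruct (H n); rewrite <- E; auto.
Qed.

Lemma comp_id X : comp X (fun n => n).
Proof. exists (CProj 0); intros n; apply (e_proj X 0 [n]). Qed.

Lemma eval_comp1 X c d xs y v :
  eval X d xs y -> eval X c [y] v -> eval X (CComp c [d]) xs v.
Proof. intros; econstructor; eauto. repeat econstructor; eauto. Qed.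

Lemma eval_comp2 X c d d' xs y y' v :
  eval X d xs y -> eval X d' xs y' -> eval X c [y; y'] v ->
  eval X (CComp c [d; d']) xs v.
Proof. intros; econstructor; eauto. repeat econstructor; eauto. Qed.

Lemma comp_comp X f g : comp X f -> comp X g -> comp X (fun n => f (g n)).
Proof.
  intros [c H] [d H']; exists (CComp c [d]); intros n.
  eapply eval_comp1; eauto.
Qed.

Lemma comp_succ X f : comp X f -> comp X (fun n => S (f n)).
Proof.
  intros [c H]; exists (CComp CSucc [c]); intros n.
  eapply eval_comp1; eauto. apply (e_succ X [f n]).
Qed.

Lemma comp_const X k : comp X (fun _ => k).
Proof.
  induction k as [|k IH].
  - exists CZero; intros; constructor.
  - apply comp_succ; auto.
Qed.

(** Two arguments are passed as a list here because pairing is not yet known to be computable.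
    Afterwards all functions are unary and arguments are packed by [pair]. *)
Definition comp_bin (X : set) (F : nat -> nat -> nat) : Prop :=
  exists c, forall x y, eval X c [x; y] (F x y).

Lemma comp_bin_app X F f g :
  comp_bin X F -> comp X f -> comp X g -> comp X (fun n => F (f n) (g n)).
Proof.
  intros [c H] [d H1] [d' H2]; exists (CComp c [d; d']); intros n.
  eapply eval_comp2; eauto.
Qed.

Lemma comp_bin_flip X F : comp_bin X F -> comp_bin X (fun x y => F y x).
Proof.
  intros [c H]; exists (CComp c [CProj 1; CProj 0]); intros x y.
  eapply eval_comp2; [apply (e_proj X 1)|apply (e_proj X 0)|apply H].
Qed.

Lemma comp_bin_comp X F f g : comp_bin X F -> comp_bin X f -> comp_bin X g ->
  comp_bin X (fun x y => F (f x y) (g x y)).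
Proof.
  intros [c H] [d H1] [d' H2]; exists (CComp c [d; d']); intros.
  eapply eval_comp2; eauto.
Qed.

Lemma comp_bin_comp1 X F f : comp X F -> comp_bin X f ->
  comp_bin X (fun x y => F (f x y)).
Proof.
  intros [c H] [d H1]; exists (CComp c [d]); intros; eapply eval_comp1; eauto.
Qed.

Lemma comp_bin_fst X : comp_bin X (fun x _ => x).
Proof. exists (CProj 0); intros; apply (e_proj X 0). Qed.

Lemma comp_bin_snd X : comp_bin X (fun _ y => y).
Proof. exists (CProj 1); intros; apply (e_proj X 1). Qed.

Lemma comp_bin_add X : comp_bin X Nat.add.
Proof.
  exists (CPrec (CProj 0) (CComp CSucc [CProj 1])); intros x y.
  induction x as [|x IH]; simpl.
  - constructor. apply (e_proj X 0).
  - econstructor; eauto. eapply eval_comp1; [apply (e_proj X 1)|].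
    apply (e_succ X [x + y]).
Qed.

Lemma comp_add X f g : comp X f -> comp X g -> comp X (fun n => f n + g n).
Proof. apply (comp_bin_app X Nat.add), comp_bin_add. Qed.

(* Parameter-free recursion, needed to compute the pairing function itself. *)
Lemma comp_iter_raw X (a : nat) (F : nat -> nat -> nat) : comp_bin X F ->
  comp X (nat_rec (fun _ => nat) a F).
Proof.
  intros [c H]. destruct (comp_const X a) as [d Hd].
  (* The base case runs on the empty list, whereas [d] is only specified on one-element lists;
     composing with [CZero] supplies an argument. *)
  exists (CComp (CPrec (CComp d [CZero]) c) [CProj 0]); intros n.
  eapply eval_comp1; [apply (e_proj X 0)|]. simpl.
  assert (K : forall xs, eval X (CComp d [CZero]) xs a).
  { intros; eapply eval_comp1; [constructor|apply Hd]. }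
  induction n; simpl; econstructor; eauto.
Qed.

Lemma comp_pred X : comp X Nat.pred.
Proof.
  eapply comp_ext; [apply (comp_iter_raw X 0 (fun i _ => i)), comp_bin_fst|].
  intros [|n]; reflexivity.
Qed.

Lemma comp_bin_sub X : comp_bin X Nat.sub.
Proof.
  apply (comp_bin_flip X (fun x y => y - x)).
  destruct (comp_pred X) as [c H].
  exists (CPrec (CProj 0) (CComp c [CProj 1])); intros x y.
  induction x as [|x IH].
  - constructor. rewrite Nat.sub_0_r. apply (e_proj X 0).
  - econstructor; eauto. eapply eval_comp1; [apply (e_proj X 1)|].
    simpl nth. replace (y - S x) with (Nat.pred (y - x)) by lia. apply H.
Qed.

Lemma comp_sub X f g : comp X f -> comp X g -> comp X (fun n => f n - g n).
Proof. apply (comp_bin_app X Nat.sub), comp_bin_sub. Qed.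

(** * Computability of Cantor pairing and of recursion with parameters *)

Definition triangle (n : nat) : nat :=
  nat_rec (fun _ => nat) 0 (fun i m => S i + m) n.

Lemma triangle_S n : triangle (S n) = S n + triangle n.
Proof. reflexivity. Qed.

Lemma triangle_le n m : n <= m -> triangle n <= triangle m.
Proof. induction 1; [lia|]. rewrite triangle_S; lia. Qed.

Lemma comp_triangle X : comp X triangle.
Proof.
  apply (comp_iter_raw X 0 (fun i m => S i + m)).
  apply (comp_bin_comp X Nat.add (fun i _ => S i) (fun _ m => m)).
  - apply comp_bin_add.
  - apply (comp_bin_comp1 X S); [apply comp_succ, comp_id|apply comp_bin_fst].
  - apply comp_bin_snd.
Qed.

Definition pair (x y : nat) : nat := to_nat (x, y).
Definition p1 (n : nat) : nat := fst (of_nat n).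
Definition p2 (n : nat) : nat := snd (of_nat n).

Lemma p1_pair x y : p1 (pair x y) = x.
Proof. unfold p1, pair. rewrite cancel_of_to; auto. Qed.

Lemma p2_pair x y : p2 (pair x y) = y.
Proof. unfold p2, pair. rewrite cancel_of_to; auto. Qed.

Lemma pair_p n : pair (p1 n) (p2 n) = n.
Proof. unfold p1, p2, pair. rewrite <- surjective_pairing. apply cancel_to_of. Qed.

Lemma pair_triangle x y : pair x y = y + triangle (y + x).
Proof. reflexivity. Qed.

Lemma triangle_ge n : n <= triangle n.
Proof. induction n; [auto|rewrite triangle_S; lia]. Qed.

Lemma pair_ge x y : x + y <= pair x y.
Proof. rewrite pair_triangle. pose proof (triangle_ge (y + x)). lia. Qed.

Lemma pair_lt_r x y y' : y < y' -> pair x y < pair x y'.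
Proof.
  intros H. rewrite !pair_triangle.
  assert (triangle (y + x) <= triangle (y' + x)) by (apply triangle_le; lia).
  lia.
Qed.

Lemma p1_le n : p1 n <= n.
Proof. pose proof (pair_ge (p1 n) (p2 n)). rewrite pair_p in H; lia. Qed.

Lemma p2_le n : p2 n <= n.
Proof. pose proof (pair_ge (p1 n) (p2 n)). rewrite pair_p in H; lia. Qed.

Lemma comp_bin_pair X : comp_bin X pair.
Proof.
  apply (comp_bin_comp X Nat.add (fun _ y => y) (fun x y => triangle (y + x))).
  - apply comp_bin_add.
  - apply comp_bin_snd.
  - apply (comp_bin_comp1 X triangle); [apply comp_triangle|].
    apply (comp_bin_flip X Nat.add), comp_bin_add.
Qed.

Lemma comp_pair X f g : comp X f -> comp X g -> comp X (fun n => pair (f n) (g n)).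
Proof. apply comp_bin_app, comp_bin_pair. Qed.

(* [p1 n + p2 n] is the least [s] with [n < triangle (S s)]. *)
Lemma comp_psum X : comp X (fun n => p1 n + p2 n).
Proof.
  assert (K : comp_bin X (fun s n => S n - triangle (S s))).
  { apply (comp_bin_comp X Nat.sub (fun _ n => S n) (fun s _ => triangle (S s))).
    - apply comp_bin_sub.
    - apply (comp_bin_comp1 X S); [apply comp_succ, comp_id|apply comp_bin_snd].
    - apply (comp_bin_comp1 X (fun s => triangle (S s))); [|apply comp_bin_fst].
      apply comp_comp; [apply comp_triangle|apply comp_succ, comp_id]. }
  destruct K as [c H]. exists (CMu c); intros n.
  set (s := p1 n + p2 n).
  assert (E : n = p2 n + triangle s).
  { unfold s. rewrite <- (pair_p n) at 1. rewrite pair_triangle. f_equal; f_equal; lia. }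
  constructor.
  - specialize (H s n). replace (S n - triangle (S s)) with 0 in H; auto.
    rewrite triangle_S; unfold s in *; lia.
  - intros z Hz. exists (n - triangle (S z)).
    specialize (H z n). replace (S (n - _)) with (S n - triangle (S z)); auto.
    pose proof (triangle_le (S z) s). lia.
Qed.

Lemma comp_p2' X : comp X p2.
Proof.
  apply comp_ext with (f := fun n => n - triangle (p1 n + p2 n)).
  - apply comp_sub; [apply comp_id|].
    apply (comp_comp X triangle); [apply comp_triangle|apply comp_psum].
  - intros n. rewrite <- (pair_p n) at 1. rewrite pair_triangle, (Nat.add_comm (p1 n)). lia.
Qed.

Lemma comp_p1' X : comp X p1.
Proof.
  apply comp_ext with (f := fun n => (p1 n + p2 n) - p2 n).
  - apply comp_sub; [apply comp_psum|apply comp_p2'].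
  - intros n. lia.
Qed.

Lemma comp_p1 X f : comp X f -> comp X (fun n => p1 (f n)).
Proof. apply comp_comp, comp_p1'. Qed.

Lemma comp_p2 X f : comp X f -> comp X (fun n => p2 (f n)).
Proof. apply comp_comp, comp_p2'. Qed.

Definition primrec (a : nat) (F : nat -> nat -> nat) (k : nat) : nat :=
  nat_rec (fun _ => nat) a F k.

Lemma comp_primrec X (f h : nat -> nat) (F : nat -> nat -> nat -> nat) :
  comp X f -> comp X h ->
  comp X (fun z => F (p1 z) (p1 (p2 z)) (p2 (p2 z))) ->
  comp X (fun n => primrec (f n) (F n) (h n)).
Proof.
  intros [cf Hf] [ch Hh] [cg Hg]. destruct (comp_bin_pair X) as [cp Hp].
  exists (CComp (CPrec cf (CComp cg [CComp cp [CProj 2; CComp cp [CProj 0; CProj 1]]]))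
            [ch; CProj 0]).
  intros n. eapply eval_comp2; [apply Hh|apply (e_proj X 0)|].
  simpl nth. induction (h n) as [|k IH]; simpl.
  - constructor; auto.
  - econstructor; eauto.
    eapply eval_comp1.
    { eapply eval_comp2; [apply (e_proj X 2)| |apply Hp].
      eapply eval_comp2; [apply (e_proj X 0)|apply (e_proj X 1)|apply Hp]. }
    specialize (Hg (pair n (pair k (primrec (f n) (F n) k)))).
    rewrite p1_pair, p2_pair, p1_pair, p2_pair in Hg. exact Hg.
Qed.

Create HintDb cdb.
#[export] Hint Resolve comp_id comp_const comp_succ comp_add comp_sub comp_pair
  comp_p1 comp_p2 : cdb.
Ltac cmp := auto 100 with cdb nocore.

Lemma comp_predf X f : comp X f -> comp X (fun n => Nat.pred (f n)).
Proof. apply comp_comp, comp_pred. Qed.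

Lemma comp_mul X f g : comp X f -> comp X g -> comp X (fun n => f n * g n).
Proof.
  intros Hf Hg.
  apply comp_ext with (fun n => primrec 0 (fun _ r => g n + r) (f n)).
  - apply (comp_primrec X _ _ (fun n _ r => g n + r)); cmp.
    apply comp_add; cmp. apply (comp_comp X g); cmp.
  - intros n. induction (f n); simpl; auto.
Qed.

Lemma comp_pow2 X f : comp X f -> comp X (fun n => 2 ^ f n).
Proof.
  intros Hf.
  apply comp_ext with (fun n => primrec 1 (fun _ r => r + r) (f n)).
  - apply (comp_primrec X _ _ (fun _ _ r => r + r)); cmp.
  - intros n. induction (f n); simpl; auto.
    unfold primrec in *; simpl; lia.
Qed.

Lemma comp_iter X (F : nat -> nat) f h : comp X F -> comp X f -> comp X h ->
  comp X (fun n => Nat.iter (h n) F (f n)).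
Proof.
  intros HF Hf Hh.
  apply comp_ext with (fun n => primrec (f n) (fun _ r => F r) (h n)).
  - apply (comp_primrec X _ _ (fun _ _ r => F r)); auto.
    apply (comp_comp X F); cmp.
  - intros n. induction (h n); simpl; auto.
Qed.
#[export] Hint Resolve comp_predf comp_mul comp_pow2 comp_iter : cdb.

(** * Closure properties of decidable relations, and unbounded search *)

Lemma dec_app X (R : nat -> Prop) f : dec X R -> comp X f -> dec X (fun n => R (f n)).
Proof.
  rewrite !dec_chi. intros H Hf. eapply comp_ext; [apply (comp_comp X _ _ H Hf)|].
  reflexivity.
Qed.

Lemma dec_app2 X (R : nat -> nat -> Prop) f g :
  dec X (fun z => R (p1 z) (p2 z)) -> comp X f -> comp X g ->
  dec X (fun n => R (f n) (g n)).
Proof.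
  intros H Hf Hg.
  eapply dec_ext; [apply (dec_app X _ (fun n => pair (f n) (g n)) H); cmp|].
  intros n; cbv beta. rewrite p1_pair, p2_pair. tauto.
Qed.

Lemma dec_app3 X (R : nat -> nat -> nat -> Prop) f g h :
  dec X (fun z => R (p1 z) (p1 (p2 z)) (p2 (p2 z))) -> comp X f -> comp X g ->
  comp X h -> dec X (fun n => R (f n) (g n) (h n)).
Proof.
  intros H Hf Hg Hh.
  eapply dec_ext;
    [apply (dec_app X _ (fun n => pair (f n) (pair (g n) (h n))) H); cmp|].
  intros n; cbv beta. rewrite !p2_pair, !p1_pair, ?p2_pair. tauto.
Qed.

Lemma dec_nonzero X f : comp X f -> dec X (fun n => f n <> 0).
Proof.
  intros Hf. apply dec_chi.
  apply comp_ext with (fun n => 1 - (1 - f n)); [cmp|].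
  intros n. destruct (Nat.eq_dec (f n) 0) as [e|e].
  - rewrite chi_false by tauto. lia.
  - rewrite chi_true by tauto. lia.
Qed.

Lemma dec_not X R : dec X R -> dec X (fun n => ~ R n).
Proof.
  rewrite !dec_chi. intros H. apply comp_ext with (fun n => 1 - chi R n); [cmp|].
  intros n. destruct (classic (R n)).
  - rewrite chi_true, (chi_false (fun n => ~ R n)); tauto.
  - rewrite chi_false, (chi_true (fun n => ~ R n)); tauto.
Qed.

Lemma dec_and X R R' : dec X R -> dec X R' -> dec X (fun n => R n /\ R' n).
Proof.
  rewrite !dec_chi. intros H H'.
  apply comp_ext with (fun n => chi R n * chi R' n); [cmp|].
  intros n. destruct (classic (R n)); destruct (classic (R' n));
    rewrite ?(chi_true R), ?(chi_true R'), ?(chi_false R), ?(chi_false R') by auto;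
    first [rewrite chi_true by tauto | rewrite chi_false by tauto]; auto.
Qed.

Lemma dec_or X R R' : dec X R -> dec X R' -> dec X (fun n => R n \/ R' n).
Proof.
  intros H H'. eapply dec_ext;
    [exact (dec_not X _ (dec_and X _ _ (dec_not X _ H) (dec_not X _ H')))|].
  intros n; cbv beta. destruct (classic (R n)), (classic (R' n)); tauto.
Qed.

Lemma dec_imp X R R' : dec X R -> dec X R' -> dec X (fun n => R n -> R' n).
Proof.
  intros H H'. eapply dec_ext; [exact (dec_or X _ _ (dec_not X _ H) H')|].
  intros n; cbv beta. destruct (classic (R n)), (classic (R' n)); tauto.
Qed.

Lemma dec_iff X R R' : dec X R -> dec X R' -> dec X (fun n => R n <-> R' n).
Proof. intros H H'. apply dec_and; apply dec_imp; auto. Qed.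

Lemma dec_le X f g : comp X f -> comp X g -> dec X (fun n => f n <= g n).
Proof.
  intros. eapply dec_ext; [apply dec_not, (dec_nonzero X (fun n => f n - g n)); cmp|].
  intros n; cbv beta; lia.
Qed.

Lemma dec_lt X f g : comp X f -> comp X g -> dec X (fun n => f n < g n).
Proof. intros. apply dec_le; cmp. Qed.

Lemma dec_eq X f g : comp X f -> comp X g -> dec X (fun n => f n = g n).
Proof.
  intros. eapply dec_ext; [apply dec_and; apply dec_le; [exact H|exact H0|exact H0|exact H]|].
  intros n; cbv beta; lia.
Qed.

(** Non-uniform: one of the two constant programs is correct, and which one is decided
    classically. *)
Lemma dec_const X (A : Prop) : dec X (fun _ => A).
Proof.
  apply dec_chi. apply comp_ext with (fun _ => chi (fun _ => A) 0); [cmp|].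
  reflexivity.
Qed.

Lemma dec_ball X (b : nat -> nat) (R : nat -> nat -> Prop) :
  comp X b -> dec X (fun z => R (p1 z) (p2 z)) ->
  dec X (fun n => forall i, i < b n -> R n i).
Proof.
  intros Hb HR. apply dec_chi in HR. apply dec_chi.
  apply comp_ext with
    (fun n => primrec 1 (fun i r => r * chi (fun z => R (p1 z) (p2 z)) (pair n i)) (b n)).
  - apply (comp_primrec X _ _
      (fun n i r => r * chi (fun z => R (p1 z) (p2 z)) (pair n i))); cmp.
    apply comp_mul; cmp. apply (comp_comp X _ (fun z => pair (p1 z) (p1 (p2 z))) HR). cmp.
  - intros n. unfold chi at 2.
    destruct excluded_middle_informative as [H|H].
    + induction (b n) as [|k IH]; simpl; auto.
      unfold primrec in *; simpl. rewrite IH by auto.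
      rewrite chi_true; auto. rewrite p1_pair, p2_pair. auto.
    + induction (b n) as [|k IH]; simpl.
      * destruct H; intros; lia.
      * unfold primrec in *; simpl.
        destruct (classic (R n k)) as [h|h].
        -- rewrite IH; [auto|]. intros G. apply H. intros i Hi.
           destruct (Nat.eq_dec i k); [subst; auto|apply G; lia].
        -- rewrite chi_false; [lia|]. rewrite p1_pair, p2_pair. auto.
Qed.

Lemma dec_bex X (b : nat -> nat) (R : nat -> nat -> Prop) :
  comp X b -> dec X (fun z => R (p1 z) (p2 z)) ->
  dec X (fun n => exists i, i < b n /\ R n i).
Proof.
  intros Hb HR.
  eapply dec_ext; [apply dec_not, (dec_ball X b (fun n i => ~ R n i) Hb), dec_not, HR|].
  intros n; cbv beta. split.
  - intros H. apply NNPP. intros K. apply H. intros i Hi Ri. apply K; eauto.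
  - intros [i [Hi Ri]] H. apply (H i); auto.
Qed.
#[export] Hint Resolve dec_not dec_and dec_or dec_imp dec_iff dec_le dec_lt dec_eq dec_const
  dec_ball dec_bex : cdb.

Lemma dec_oracle X : dec X X.
Proof. exists COracle; intros n; split; intros; constructor; auto. Qed.

Lemma comp_search X (R : nat -> nat -> Prop) :
  dec X (fun z => R (p1 z) (p2 z)) -> (forall n, exists k, R n k) ->
  exists g, comp X g /\ forall n, R n (g n).
Proof.
  intros HR Hex.
  assert (K : comp X (fun z => 1 - chi (fun z => R (p1 z) (p2 z)) z)).
  { apply dec_chi in HR. cmp. }
  destruct K as [c Hc]. destruct (comp_bin_pair X) as [cp Hp].
  assert (Hmin : forall n, exists k, R n k /\ forall z, z < k -> ~ R n z).
  { intros n. destruct (Hex n) as [k Hk]. revert Hk.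
    induction k as [k IH] using lt_wf_ind. intros Hk.
    destruct (classic (exists z, z < k /\ R n z)) as [[z [Hz Rz]]|N]; [eauto|].
    exists k; split; auto. intros z Hz Rz; apply N; eauto. }
  (* Choosing the least witness makes [g] agree with the value that [CMu] returns. *)
  pose (g := fun n => proj1_sig (constructive_indefinite_description _ (Hmin n))).
  assert (Hg : forall n, R n (g n) /\ forall z, z < g n -> ~ R n z).
  { intros n. unfold g. destruct constructive_indefinite_description; auto. }
  exists g; split; [|apply Hg].
  exists (CMu (CComp c [CComp cp [CProj 1; CProj 0]])). intros n.
  destruct (Hg n) as [H1 H2].
  assert (E : forall k, eval X (CComp c [CComp cp [CProj 1; CProj 0]]) [k; n]
               (1 - chi (fun z => R (p1 z) (p2 z)) (pair n k))).
  { intros k. eapply eval_comp1; [|apply Hc].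
    eapply eval_comp2; [apply (e_proj X 1)|apply (e_proj X 0)|apply Hp]. }
  constructor.
  - specialize (E (g n)). rewrite chi_true in E; auto. rewrite p1_pair, p2_pair; auto.
  - intros z Hz. exists 0. specialize (E z).
    rewrite chi_false in E; auto. rewrite p1_pair, p2_pair; auto.
Qed.

Lemma search_code X (R : nat -> nat -> Prop) :
  dec X (fun z => R (p1 z) (p2 z)) ->
  exists c, forall n, (exists v, eval X c [n] v) <-> exists k, R n k.
Proof.
  intros HR.
  assert (K : comp X (fun z => 1 - chi (fun z => R (p1 z) (p2 z)) z)).
  { apply dec_chi in HR. cmp. }
  destruct K as [c Hc]. destruct (comp_bin_pair X) as [cp Hp].
  assert (E : forall k n, eval X (CComp c [CComp cp [CProj 1; CProj 0]]) [k; n]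
               (1 - chi (fun z => R (p1 z) (p2 z)) (pair n k))).
  { intros k n. eapply eval_comp1; [|apply Hc].
    eapply eval_comp2; [apply (e_proj X 1)|apply (e_proj X 0)|apply Hp]. }
  exists (CMu (CComp c [CComp cp [CProj 1; CProj 0]])). intros n; split.
  - intros [v Hv]. inversion Hv; subst. exists v.
    match goal with H : eval _ _ _ 0 |- _ => pose proof (eval_det _ _ _ _ H _ (E v n)) as D end.
    apply NNPP. intros N. rewrite chi_false in D; [discriminate|].
    rewrite p1_pair, p2_pair; auto.
  - intros [k Hk]. revert Hk. induction k as [k IH] using lt_wf_ind. intros Hk.
    destruct (classic (exists z, z < k /\ R n z)) as [[z [Hz Rz]]|N]; [eauto|].
    exists k. constructor.
    + specialize (E k n). rewrite chi_true in E; auto. rewrite p1_pair, p2_pair; auto.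
    + intros z Hz. exists 0. specialize (E z n).
      rewrite chi_false in E; auto. rewrite p1_pair, p2_pair; eauto.
Qed.

Lemma dec_ball_le X (b : nat -> nat) (R : nat -> nat -> Prop) :
  comp X b -> dec X (fun z => R (p1 z) (p2 z)) ->
  dec X (fun n => forall i, i <= b n -> R n i).
Proof.
  intros Hb HR. eapply dec_ext; [apply (dec_ball X (fun n => S (b n)) R); cmp|].
  intros n; cbv beta. split; intros H i Hi; apply H; lia.
Qed.

Lemma dec_bex_le X (b : nat -> nat) (R : nat -> nat -> Prop) :
  comp X b -> dec X (fun z => R (p1 z) (p2 z)) ->
  dec X (fun n => exists i, i <= b n /\ R n i).
Proof.
  intros Hb HR. eapply dec_ext; [apply (dec_bex X (fun n => S (b n)) R); cmp|].
  intros n; cbv beta. split; intros [i [Hi Ri]]; exists i; split; auto; lia.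
Qed.
#[export] Hint Resolve dec_ball_le dec_bex_le : cdb.

(** * Finite binary strings *)

(** Expresses a bit by addition, multiplication and powers, so that bits become decidable by bounded
    search. *)
Lemma testbit_decomp a q b i r : a = (2 * q + b) * 2 ^ i + r -> r < 2 ^ i -> b <= 1 ->
  (Nat.testbit a i = true <-> b = 1).
Proof.
  intros E Hr Hb. rewrite Nat.testbit_true.
  assert (D : a / 2 ^ i = 2 * q + b).
  { symmetry. apply Nat.div_unique with r; lia. }
  rewrite D. replace (2 * q + b) with (b + q * 2) by lia.
  rewrite Nat.Div0.mod_add, Nat.mod_small by lia. tauto.
Qed.

Lemma testbit_decomp_ex a i : exists q b r, a = (2 * q + b) * 2 ^ i + r /\ r < 2 ^ i /\ b <= 1.
Proof.
  exists (a / 2 ^ i / 2), (a / 2 ^ i mod 2), (a mod 2 ^ i).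
  assert (2 ^ i <> 0) by (apply Nat.pow_nonzero; lia).
  rewrite <- Nat.div_mod_eq.
  pose proof (Nat.div_mod_eq a (2 ^ i)).
  pose proof (Nat.mod_upper_bound a (2 ^ i)).
  pose proof (Nat.mod_upper_bound (a / 2 ^ i) 2). lia.
Qed.

(* With the coding [code_str], [S s] is the binary number whose leading digit
   marks the length and whose lower digits are the bits of the string. *)
Definition slen (s : nat) : nat := Nat.log2 (S s).
Definition sset (s : nat) : set :=
  fun i => i < slen s /\ Nat.testbit (S s) i = true.

Lemma comp_slen X f : comp X f -> comp X (fun n => slen (f n)).
Proof.
  intros Hf. apply (comp_comp X slen); auto.
  destruct (comp_search X (fun n k => 2 ^ k <= S n /\ S n < 2 ^ (S k))) as [g [Hg Eg]].
  - cmp.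
  - intros n. exists (Nat.log2 (S n)). apply Nat.log2_spec; lia.
  - apply comp_ext with g; auto. intros n. symmetry. apply Nat.log2_unique; [lia|apply Eg].
Qed.

Lemma dec_testbit X f g : comp X f -> comp X g ->
  dec X (fun n => Nat.testbit (f n) (g n) = true).
Proof.
  intros Hf Hg.
  apply (dec_app2 X (fun a i => Nat.testbit a i = true)); auto.
  eapply dec_ext.
  - apply (dec_bex X (fun z => S (p1 z)) (fun z q => exists r, r < 2 ^ (p2 z) /\
      p1 z = (2 * q + 1) * 2 ^ (p2 z) + r)); cmp.
  - intros z; cbv beta. split.
    + intros [q [_ [r [Hr E]]]]. apply (testbit_decomp _ _ _ _ _ E Hr); auto.
    + intros H. destruct (testbit_decomp_ex (p1 z) (p2 z)) as [q [b [r [E [Hr Hb]]]]].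
      assert (b = 1) by (apply (testbit_decomp _ _ _ _ _ E Hr); auto). subst b.
      exists q; split.
      * assert (2 ^ p2 z <> 0) by (apply Nat.pow_nonzero; lia).
        assert (q <= (2 * q + 1) * 2 ^ p2 z) by nia. lia.
      * exists r; auto.
Qed.
#[export] Hint Resolve comp_slen dec_testbit : cdb.

Lemma dec_sset X f g : comp X f -> comp X g -> dec X (fun n => sset (f n) (g n)).
Proof. intros. unfold sset. cmp. Qed.
#[export] Hint Resolve dec_sset : cdb.

(** The code of the initial segment of [Y] of length [k]. Adding [2 ^ k] moves the leading digit of
    the successor up by one place; a second [2 ^ k] sets bit [k] when [k] lies in [Y]. *)
Definition pre (Y : set) (k : nat) : nat :=
  primrec 0 (fun i r => r + 2 ^ i * S (chi Y i)) k.

Lemma pre_S Y k : pre Y (S k) = pre Y k + 2 ^ k * S (chi Y k).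
Proof. reflexivity. Qed.

Lemma chi_le R n : chi R n <= 1.
Proof. unfold chi; destruct excluded_middle_informative; lia. Qed.

Lemma pre_bound Y k : 2 ^ k <= S (pre Y k) < 2 ^ (S k).
Proof.
  induction k as [|k IH].
  - cbn. lia.
  - rewrite pre_S. simpl Nat.pow in *. pose proof (chi_le Y k).
    destruct (chi Y k) as [|[|]]; lia.
Qed.

Lemma slen_pre Y k : slen (pre Y k) = k.
Proof. apply Nat.log2_unique; [lia|apply pre_bound]. Qed.

Lemma pre_decomp Y k i : i < k ->
  exists q r, S (pre Y k) = (2 * q + chi Y i) * 2 ^ i + r /\ r < 2 ^ i.
Proof.
  induction k as [|k IH]; [lia|]. intros Hi.
  rewrite pre_S. destruct (Nat.eq_dec i k) as [->|N].
  - pose proof (pre_bound Y k). simpl Nat.pow in H.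
    exists 1, (S (pre Y k) - 2 ^ k).
    split; [|lia]. destruct (chi Y k) as [|[|]] eqn:?; lia.
  - destruct IH as [q [r [E Hr]]]; [lia|].
    exists (q + 2 ^ (k - S i) * S (chi Y k)), r. split; auto.
    rewrite <- Nat.add_succ_l, E.
    replace (2 ^ k) with (2 * 2 ^ (k - S i) * 2 ^ i).
    + ring.
    + replace k with (S (k - S i) + i) at 2 by lia.
      rewrite Nat.pow_add_r, Nat.pow_succ_r'. ring.
Qed.

Lemma sset_pre Y k i : sset (pre Y k) i <-> i < k /\ Y i.
Proof.
  unfold sset. rewrite slen_pre.
  split; intros [Hi H]; split; auto;
    destruct (pre_decomp Y k i Hi) as [q [r [E Hr]]];
    pose proof (testbit_decomp _ _ _ _ _ E Hr (chi_le Y i)) as T;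
    rewrite chi_spec in T; tauto.
Qed.

Lemma sset_lt s i : sset s i -> i < slen s.
Proof. intros [H _]; auto. Qed.

Lemma str_ext s s' : slen s = slen s' ->
  (forall i, i < slen s -> (sset s i <-> sset s' i)) -> s = s'.
Proof.
  intros L H. apply Nat.succ_inj. apply Nat.bits_inj. intros i.
  destruct (lt_eq_lt_dec i (slen s)) as [[h|h]|h].
  - specialize (H i h). unfold sset in H. rewrite <- L in H.
    destruct (Nat.testbit (S s) i), (Nat.testbit (S s') i); auto; intuition discriminate.
  - subst i. rewrite L at 2. unfold slen. rewrite !Nat.bit_log2; lia.
  - rewrite !Nat.bits_above_log2; auto. unfold slen in *; lia.
Qed.

Lemma pre_sset s : pre (sset s) (slen s) = s.
Proof.
  apply str_ext; [apply slen_pre|]. rewrite slen_pre. intros i Hi.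
  rewrite sset_pre. tauto.
Qed.

Lemma pre_ext (Y Y' : set) k : (forall i, i < k -> (Y i <-> Y' i)) -> pre Y k = pre Y' k.
Proof.
  intros H. apply str_ext; rewrite !slen_pre; auto.
  intros i Hi. rewrite !sset_pre, H by auto. tauto.
Qed.

Lemma pre_pre Y k j : j <= k -> pre (sset (pre Y k)) j = pre Y j.
Proof. intros H. apply pre_ext. intros i Hi. rewrite sset_pre. intuition lia. Qed.

Lemma slen_le s : slen s <= s.
Proof.
  unfold slen. destruct s; [cbn; lia|]. pose proof (Nat.log2_lt_lin (S (S s))). lia.
Qed.

Lemma comp_pre X (Y : nat -> set) f g :
  dec X (fun z => Y (p1 z) (p2 z)) -> comp X f -> comp X g ->
  comp X (fun n => pre (Y (f n)) (g n)).
Proof.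
  intros HY Hf Hg.
  apply (comp_primrec X (fun _ => 0) g (fun n i r => r + 2 ^ i * S (chi (Y (f n)) i))); cmp.
  apply comp_add; [cmp|]. apply comp_mul; [cmp|]. apply comp_succ.
  apply (dec_chi X (fun z => Y (f (p1 z)) (p1 (p2 z)))).
  apply (dec_app2 X Y); cmp. apply (comp_comp X f); cmp.
Qed.

Lemma comp_pre1 X (Y : set) g : dec X Y -> comp X g -> comp X (fun n => pre Y (g n)).
Proof.
  intros HY Hg. apply (comp_pre X (fun _ => Y) (fun _ => 0)); cmp.
  apply (dec_app X Y); cmp.
Qed.

Lemma comp_pre_sset X s g : comp X s -> comp X g -> comp X (fun n => pre (sset (s n)) (g n)).
Proof. intros. apply (comp_pre X sset); cmp. Qed.
#[export] Hint Resolve comp_pre_sset : cdb.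

Lemma code_str_pre (l : list bool) :
  code_str l = pre (fun i => nth i l false = true) (length l).
Proof.
  (* [code_str] recurses on the first bit and [pre] on the last, so prepending a bit has to be
     matched separately. *)
  assert (G : forall (Y : set) k b, (b = true <-> Y 0) ->
     pre Y (S k) = 2 * pre (fun i => Y (S i)) k + (if b then 2 else 1)).
  { intros Y k b Hb. induction k as [|k IH].
    - rewrite pre_S. destruct b.
      + rewrite chi_true; [reflexivity|apply Hb; auto].
      + rewrite chi_false; [reflexivity|intros H; apply Hb in H; discriminate].
    - rewrite pre_S, IH, (pre_S (fun i => Y (S i)) k).
      change (chi (fun i => Y (S i)) k) with (chi Y (S k)).
      rewrite Nat.pow_succ_r'. ring. }
  induction l as [|b l IH]; [reflexivity|].
  simpl length. rewrite (G _ _ b) by (simpl; tauto).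
  simpl code_str. rewrite IH. reflexivity.
Qed.

Lemma pre_init_seg f k : code_str (init_seg f k) = pre (as_set f) k.
Proof.
  rewrite code_str_pre. unfold init_seg. rewrite length_map, length_seq.
  apply pre_ext. intros i Hi.
  rewrite nth_indep with (d' := f 0) by (rewrite length_map, length_seq; auto).
  rewrite map_nth, seq_nth by auto. unfold as_set. simpl; tauto.
Qed.

Definition char_fun (Y : set) (i : nat) : bool :=
  if excluded_middle_informative (Y i) then true else false.

Lemma as_set_char Y i : as_set (char_fun Y) i <-> Y i.
Proof.
  unfold as_set, char_fun. destruct excluded_middle_informative; intuition discriminate.
Qed.

(** * C.e. relations *)

Definition re (X : set) (R : nat -> Prop) : Prop :=
  exists S : nat -> nat -> Prop, dec X (fun z => S (p1 z) (p2 z)) /\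
    forall n, R n <-> exists k, S n k.

Lemma re_ext X (R R' : nat -> Prop) : re X R -> (forall n, R n <-> R' n) -> re X R'.
Proof. intros [S [H E]] K. exists S; split; auto. intros n; rewrite <- K; auto. Qed.

Lemma re_dec X R : dec X R -> re X R.
Proof.
  intros H. exists (fun n _ => R n); split.
  - apply (dec_app X R); cmp.
  - intros n; split; [exists 0; auto|intros [_ h]; auto].
Qed.

Lemma re_app X R f : re X R -> comp X f -> re X (fun n => R (f n)).
Proof.
  intros [S [H E]] Hf. exists (fun n k => S (f n) k); split; [|intros; apply E].
  apply (dec_app2 X S); cmp. apply (comp_comp X f); cmp.
Qed.

Lemma re_app2 X (R : nat -> nat -> Prop) f g :
  re X (fun z => R (p1 z) (p2 z)) -> comp X f -> comp X g ->
  re X (fun n => R (f n) (g n)).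
Proof.
  intros H Hf Hg. eapply re_ext; [apply (re_app X _ (fun n => pair (f n) (g n)) H); cmp|].
  intros n; cbv beta. rewrite p1_pair, p2_pair. tauto.
Qed.

Lemma re_ex X (R : nat -> nat -> Prop) :
  re X (fun z => R (p1 z) (p2 z)) -> re X (fun n => exists k, R n k).
Proof.
  intros [S [H E]]. exists (fun n k => S (pair n (p1 k)) (p2 k)); split.
  - apply (dec_app2 X S); cmp.
  - intros n; split.
    + intros [k Hk]. specialize (E (pair n k)). cbv beta in E.
      rewrite p1_pair, p2_pair in E. apply E in Hk. destruct Hk as [j Hj].
      exists (pair k j). rewrite p1_pair, p2_pair; auto.
    + intros [k Hk]. exists (p1 k). specialize (E (pair n (p1 k))). cbv beta in E.
      rewrite p1_pair, p2_pair in E. apply E. eauto.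
Qed.

Lemma re_and X R R' : re X R -> re X R' -> re X (fun n => R n /\ R' n).
Proof.
  intros [S [H E]] [S' [H' E']].
  exists (fun n k => S n (p1 k) /\ S' n (p2 k)); split.
  - apply dec_and; [apply (dec_app2 X S)|apply (dec_app2 X S')]; cmp.
  - intros n. rewrite E, E'. split.
    + intros [[k Hk] [j Hj]]. exists (pair k j). rewrite p1_pair, p2_pair; auto.
    + intros [k [H1 H2]]; eauto.
Qed.

Lemma bounded_collection (b : nat) (R : nat -> nat -> Prop) :
  (forall i, i < b -> exists k, R i k) ->
  exists K, forall i, i < b -> exists k, k < K /\ R i k.
Proof.
  induction b as [|b IH]; intros H; [exists 0; intros; lia|].
  destruct IH as [K HK]; [intros; apply H; lia|].
  destruct (H b) as [k Hk]; [lia|].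
  exists (S (K + k)). intros i Hi. destruct (Nat.eq_dec i b) as [->|N].
  - exists k; split; auto; lia.
  - destruct (HK i) as [j [Hj Rj]]; [lia|]. exists j; split; auto; lia.
Qed.

Lemma re_ball X (b : nat -> nat) (R : nat -> nat -> Prop) :
  comp X b -> re X (fun z => R (p1 z) (p2 z)) ->
  re X (fun n => forall i, i < b n -> R n i).
Proof.
  intros Hb [S [H E]].
  exists (fun n K => forall i, i < b n -> exists k, k < K /\ S (pair n i) k); split.
  - apply (dec_ball X (fun z => b (p1 z))
             (fun z i => exists k, k < p2 z /\ S (pair (p1 z) i) k)).
    { apply (comp_comp X b); cmp. }
    apply (dec_bex X (fun z => p2 (p1 z)) (fun z k => S (pair (p1 (p1 z)) (p2 z)) k)); [cmp|].
    apply (dec_app2 X S); cmp.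
  - assert (E' : forall n i, R n i <-> exists k, S (pair n i) k).
    { intros n i. specialize (E (pair n i)). cbv beta in E.
      rewrite p1_pair, p2_pair in E. auto. }
    intros n. split.
    + intros G. apply bounded_collection. intros i Hi. apply E'; auto.
    + intros [K HK] i Hi. apply E'. destruct (HK i Hi) as [k [_ Hk]]; eauto.
Qed.

(** * Oracle substitution and transitivity of reducibility *)

Fixpoint subst_oracle (d c : code) {struct c} : code :=
  match c with
  | COracle => CComp d [CProj 0]
  | CComp f gs => CComp (subst_oracle d f) (map (subst_oracle d) gs)
  | CPrec f g => CPrec (subst_oracle d f) (subst_oracle d g)
  | CMu f => CMu (subst_oracle d f)
  | _ => c
  end.

Lemma eval_subst_oracle X Y d : (forall n, eval X d [n] (chi Y n)) ->
  forall c xs v, eval Y c xs v -> eval X (subst_oracle d c) xs v.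
Proof.
  intros Hd.
  assert (Ho : forall xs, eval X (CComp d [CProj 0]) xs (chi Y (hd 0 xs))).
  { intros xs. eapply eval_comp1; [apply (e_proj X 0)|].
    replace (nth 0 xs 0) with (hd 0 xs) by (destruct xs; auto). apply Hd. }
  apply (eval_strong_ind Y (fun c xs v => eval X (subst_oracle d c) xs v)
    (fun gs xs vs => evals X (map (subst_oracle d) gs) xs vs)); simpl;
    intros; try (econstructor; eauto; fail).
  - specialize (Ho xs). rewrite chi_true in Ho; auto.
  - specialize (Ho xs). rewrite chi_false in Ho; auto.
Qed.

Lemma comp_trans X Y f : dec X Y -> comp Y f -> comp X f.
Proof.
  intros H [c Hc]. apply dec_chi in H. destruct H as [d Hd].
  exists (subst_oracle d c). intros n. apply (eval_subst_oracle X Y); auto.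
Qed.

Lemma dec_trans X Y R : dec X Y -> dec Y R -> dec X R.
Proof. rewrite (dec_chi X R), (dec_chi Y R). apply comp_trans. Qed.

Lemma re_trans X Y R : dec X Y -> re Y R -> re X R.
Proof. intros H [S [HS E]]. exists S; split; auto. apply dec_trans with Y; auto. Qed.

Lemma dec_empty X : dec X emptyset.
Proof. apply (dec_ext X (fun _ => False)); [cmp|]. unfold emptyset; tauto. Qed.

(** * Indices and the universal relation *)

Definition decodes (m : nat) : list code := decodes_f (S m) m.

Lemma decode_f_S fu n : decode_f (S fu) n =
  match p1 n with
  | 0 => CZero
  | 1 => CSucc
  | 2 => CProj (p2 n)
  | 3 => COracle
  | 4 => CComp (decode_f fu (p1 (p2 n))) (decodes_f fu (p2 (p2 n)))
  | 5 => CPrec (decode_f fu (p1 (p2 n))) (decode_f fu (p2 (p2 n)))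
  | 6 => CMu (decode_f fu (p2 n))
  | _ => CZero
  end.
Proof.
  simpl. unfold p1, p2. destruct (of_nat n) as [tag r]. simpl.
  destruct (of_nat r) as [a b]. reflexivity.
Qed.

Lemma decodes_f_S fu m : decodes_f (S fu) m =
  match m with
  | 0 => []
  | S m' => decode_f fu (p1 m') :: decodes_f fu (p2 m')
  end.
Proof.
  simpl. unfold p1, p2. destruct m as [|m]; auto. destruct (of_nat m) as [a b]. reflexivity.
Qed.

Lemma p_sum_le n : p1 n + p2 n <= n.
Proof. pose proof (pair_ge (p1 n) (p2 n)). rewrite pair_p in H; lia. Qed.

(** Wherever decoding recurses, the tag (or the successor, in a list) makes the components strictly
    smaller, so every fuel above [n] gives the same code. *)
Lemma decode_fuel n : forall fu, n < fu ->
  decode_f fu n = decode n /\ decodes_f fu n = decodes n.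
Proof.
  induction n as [n IH] using lt_wf_ind. intros [|fu] Hfu; [lia|].
  assert (G : forall k fu', k < n -> k < fu' -> decode_f fu' k = decode k).
  { intros; apply IH; auto. }
  assert (G' : forall k fu', k < n -> k < fu' -> decodes_f fu' k = decodes k).
  { intros; apply IH; auto. }
  split.
  - unfold decode. rewrite !decode_f_S.
    pose proof (p_sum_le n). pose proof (p_sum_le (p2 n)).
    destruct (p1 n) as [|[|[|[|[|[|[|?]]]]]]]; auto; rewrite !G, ?G' by lia; auto.
  - unfold decodes. rewrite !decodes_f_S. destruct n as [|n]; auto.
    pose proof (p_sum_le n). rewrite !G, !G' by lia; auto.
Qed.

Lemma decode_eq n : decode n =
  match p1 n with
  | 0 => CZero
  | 1 => CSucc
  | 2 => CProj (p2 n)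
  | 3 => COracle
  | 4 => CComp (decode (p1 (p2 n))) (decodes (p2 (p2 n)))
  | 5 => CPrec (decode (p1 (p2 n))) (decode (p2 (p2 n)))
  | 6 => CMu (decode (p2 n))
  | _ => CZero
  end.
Proof.
  unfold decode at 1. rewrite decode_f_S.
  pose proof (p_sum_le n). pose proof (p_sum_le (p2 n)).
  destruct (p1 n) as [|[|[|[|[|[|[|?]]]]]]]; auto; f_equal; apply decode_fuel; lia.
Qed.

Lemma decodes_S m : decodes (S m) = decode (p1 m) :: decodes (p2 m).
Proof.
  unfold decodes at 1. rewrite decodes_f_S. pose proof (p_sum_le m).
  f_equal; apply decode_fuel; lia.
Qed.

Section CodeInd.
Variable P : code -> Prop.
Hypothesis Hz : P CZero.
Hypothesis Hs : P CSucc.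
Hypothesis Hp : forall i, P (CProj i).
Hypothesis Ho : P COracle.
Hypothesis Hc : forall f gs, P f -> Forall P gs -> P (CComp f gs).
Hypothesis Hr : forall f g, P f -> P g -> P (CPrec f g).
Hypothesis Hm : forall f, P f -> P (CMu f).
Fixpoint code_nested_ind (c : code) : P c :=
  match c with
  | CZero => Hz
  | CSucc => Hs
  | CProj i => Hp i
  | COracle => Ho
  | CComp f gs => Hc f gs (code_nested_ind f)
      ((fix go l : Forall P l :=
          match l with
          | [] => Forall_nil P
          | g :: l => Forall_cons g (code_nested_ind g) (go l)
          end) gs)
  | CPrec f g => Hr f g (code_nested_ind f) (code_nested_ind g)
  | CMu f => Hm f (code_nested_ind f)
  end.
End CodeInd.

Lemma decode_onto c : exists e, decode e = c.
Proof.
  induction c as [| |i| |f gs [a Ha] Hgs|f g [a Ha] [b Hb]|f [a Ha]] using code_nested_ind.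
  - exists (pair 0 0); rewrite decode_eq, p1_pair; auto.
  - exists (pair 1 0); rewrite decode_eq, p1_pair; auto.
  - exists (pair 2 i); rewrite decode_eq, p1_pair, p2_pair; auto.
  - exists (pair 3 0); rewrite decode_eq, p1_pair; auto.
  - assert (L : exists b, decodes b = gs).
    { induction Hgs as [|g gs [b Hb] _ [bs Hbs]].
      - exists 0; auto.
      - exists (S (pair b bs)). rewrite decodes_S, p1_pair, p2_pair. congruence. }
    destruct L as [b Hb]. exists (pair 4 (pair a b)).
    rewrite decode_eq, p1_pair, p2_pair, p1_pair, p2_pair. congruence.
  - exists (pair 5 (pair a b)). rewrite decode_eq, p1_pair, p2_pair, p1_pair, p2_pair. congruence.
  - exists (pair 6 a). rewrite decode_eq, p1_pair, p2_pair. congruence.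
Qed.

Definition univ (X : set) (e n : nat) : Prop := exists v, eval X (decode e) [n] v.

Lemma re_index X R : re X R -> exists e, forall n, R n <-> univ X e n.
Proof.
  intros [S [H E]]. destruct (search_code X S H) as [c Hc].
  destruct (decode_onto c) as [e He]. exists e. intros n.
  unfold univ. rewrite He, Hc. apply E.
Qed.

(* The index [e] of the jump is its own input, so the argument [n] is stored in
   [e] as the dummy projection [CProj n] and recovered by unpairing. *)
Lemma re_dec_jump X R : re X R -> dec (jump X) R.
Proof.
  intros [S [HS E]]. destruct (search_code X S HS) as [c Hc].
  set (ext := fun e => p2 (p1 (Nat.pred (p2 (Nat.pred (p2 (p2 e))))))).
  assert (Hext : comp X ext) by (unfold ext; cmp).
  destruct Hext as [d Hd].
  destruct (decode_onto (CComp c [CProj 0])) as [a Ha].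
  destruct (decode_onto d) as [b Hb].
  set (f := fun n => pair 4 (pair a (1 + (pair b (1 + (pair (pair 2 n) 0)))))).
  assert (Hf : forall n, R n <-> jump X (f n)).
  { intros n. unfold jump. rewrite decode_eq. unfold f at 1 3 4.
    rewrite p1_pair, p2_pair, p1_pair, p2_pair, Ha.
    simpl Nat.add. rewrite decodes_S, p1_pair, p2_pair, decodes_S, p1_pair, p2_pair, Hb.
    rewrite (decode_eq (pair 2 n)), p1_pair, p2_pair. cbv beta iota.
    change (decodes 0) with (@nil code).
    assert (X1 : eval X d [f n] n).
    { specialize (Hd (f n)). replace (ext (f n)) with n in Hd; [exact Hd|].
      unfold ext, f. simpl Nat.add.
      rewrite !p2_pair. simpl Nat.pred. rewrite p2_pair. simpl Nat.pred.
      rewrite p1_pair, p2_pair. auto. }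
    clear Ha Hb. rewrite E, <- Hc. split; intros [v Hv]; exists v.
    - econstructor; [repeat econstructor; eauto|].
      eapply eval_comp1; [apply (e_proj X 0)|auto].
    - inversion Hv; subst.
      match goal with H : evals _ _ _ _ |- _ => inversion H; subst end.
      match goal with H : eval X d _ _ |- _ => rewrite <- (eval_det _ _ _ _ X1 _ H) in * end.
      match goal with H : eval X (CComp c _) _ _ |- _ => inversion H; subst end.
      match goal with H : evals X [CProj 0] _ _ |- _ => inversion H; subst end.
      match goal with H : evals X [] _ _ |- _ => inversion H; subst end.
      match goal with H : evals X [] _ _ |- _ => inversion H; subst end.
      match goal with H : eval X (CProj 0) _ _ |- _ => inversion H; subst end.
      assumption. }
  eapply dec_ext; [apply (dec_app (jump X) (jump X) f); [apply dec_oracle|unfold f; cmp]|].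
  intros n; cbv beta; rewrite Hf; tauto.
Qed.

(** * Certificates for halting computations *)

Fixpoint lcode (l : list nat) : nat :=
  match l with
  | [] => 0
  | x :: l => S (pair x (lcode l))
  end.

Definition lhd (n : nat) : nat := p1 (Nat.pred n).
Definition ltl (n : nat) : nat := p2 (Nat.pred n).

Lemma lcode_onto n : exists l, lcode l = n.
Proof.
  induction n as [[|n] IH] using lt_wf_ind; [exists []; auto|].
  destruct (IH (p2 n)) as [l Hl]; [pose proof (p2_le n); lia|].
  exists (p1 n :: l). simpl. rewrite Hl, pair_p; auto.
Qed.

Lemma lhd_lcode l : lhd (lcode l) = hd 0 l.
Proof. destruct l; [reflexivity|]. unfold lhd; simpl. apply p1_pair. Qed.

Lemma ltl_lcode l : ltl (lcode l) = lcode (tl l).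
Proof. destruct l; [reflexivity|]. unfold ltl; simpl. apply p2_pair. Qed.

Lemma nth_lcode i l : lhd (Nat.iter i ltl (lcode l)) = nth i l 0.
Proof.
  assert (G : Nat.iter i ltl (lcode l) = lcode (skipn i l)).
  { revert l; induction i as [|i IH]; intros l; [reflexivity|].
    simpl Nat.iter. rewrite IH, ltl_lcode. f_equal.
    clear IH. revert l; induction i as [|i IH]; intros [|x l]; auto. apply IH. }
  rewrite G, lhd_lcode. clear G. revert l; induction i; intros [|x l]; simpl; auto.
Qed.

Lemma lcode_hd_le n : lhd n <= n.
Proof. unfold lhd. pose proof (p1_le (Nat.pred n)). lia. Qed.

Lemma comp_lhd X f : comp X f -> comp X (fun n => lhd (f n)).
Proof. intros; unfold lhd; cmp. Qed.

Lemma comp_ltl X f : comp X f -> comp X (fun n => ltl (f n)).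
Proof. intros; unfold ltl; cmp. Qed.
#[export] Hint Resolve comp_lhd comp_ltl : cdb.

(* An entry asserts, for [t = 0], that the program [c] maps the list [xs] to
   [v] and, for [t = 1], that the list of programs [c] maps [xs] to the list [v].
   A certificate is a finite set of entries in which every entry is justified by
   entries of smaller height [h]. *)
Definition entry (h t c xs v : nat) : nat := pair h (pair t (pair c (pair xs v))).
Definition ent_c (x : nat) := p1 (p2 (p2 x)).
Definition ent_xs (x : nat) := p1 (p2 (p2 (p2 x))).
Definition ent_v (x : nat) := p2 (p2 (p2 (p2 x))).

Definition premise (D : set) (h t c xs v : nat) : Prop :=
  exists h', h' < h /\ D (entry h' t c xs v).

(* [Dm] is the domain on which the oracle [O] may be queried and [Bd] bounds
   the existential quantifiers. *)
Definition justified_eval (O Dm Bd D : set) (h c xs v : nat) : Prop :=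
  ((p1 c = 0 \/ 6 < p1 c) /\ v = 0) \/
  (p1 c = 1 /\ v = S (lhd xs)) \/
  (p1 c = 2 /\ v = lhd (Nat.iter (p2 c) ltl xs)) \/
  (p1 c = 3 /\ Dm (lhd xs) /\ (O (lhd xs) /\ v = 1 \/ ~ O (lhd xs) /\ v = 0)) \/
  (p1 c = 4 /\ exists ys, Bd ys /\ (premise D h 1 (p2 (p2 c)) xs ys /\
                                    premise D h 0 (p1 (p2 c)) ys v)) \/
  (p1 c = 5 /\ xs <> 0 /\ lhd xs = 0 /\ premise D h 0 (p1 (p2 c)) (ltl xs) v) \/
  (p1 c = 5 /\ xs <> 0 /\ lhd xs <> 0 /\ exists w, Bd w /\
     (premise D h 0 c (S (pair (Nat.pred (lhd xs)) (ltl xs))) w /\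
      premise D h 0 (p2 (p2 c)) (S (pair (Nat.pred (lhd xs)) (S (pair w (ltl xs))))) v)) \/
  (p1 c = 6 /\ premise D h 0 (p2 c) (S (pair v xs)) 0 /\
     forall z, z < v -> exists w, Bd w /\ (w <> 0 /\ premise D h 0 (p2 c) (S (pair z xs)) w)).

Definition justified_evals (D : set) (h c xs v : nat) : Prop :=
  (c = 0 /\ v = 0) \/
  (c <> 0 /\ v <> 0 /\ premise D h 0 (lhd c) xs (lhd v) /\ premise D h 1 (ltl c) xs (ltl v)).

Definition justified (O Dm Bd D : set) (x : nat) : Prop :=
  (p1 (p2 x) = 0 -> justified_eval O Dm Bd D (p1 x) (ent_c x) (ent_xs x) (ent_v x)) /\
  (p1 (p2 x) = 1 -> justified_evals D (p1 x) (ent_c x) (ent_xs x) (ent_v x)).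

Lemma entry_proj h t c xs v : p1 (entry h t c xs v) = h /\
  p1 (p2 (entry h t c xs v)) = t /\ ent_c (entry h t c xs v) = c /\
  ent_xs (entry h t c xs v) = xs /\ ent_v (entry h t c xs v) = v.
Proof.
  unfold ent_c, ent_xs, ent_v, entry.
  repeat (rewrite ?p1_pair, ?p2_pair). auto.
Qed.

Lemma justified_entry0 O Dm Bd D h c xs v :
  justified O Dm Bd D (entry h 0 c xs v) <-> justified_eval O Dm Bd D h c xs v.
Proof.
  unfold justified. destruct (entry_proj h 0 c xs v) as [-> [-> [-> [-> ->]]]].
  intuition discriminate.
Qed.

Lemma justified_entry1 O Dm Bd D h c xs v :
  justified O Dm Bd D (entry h 1 c xs v) <-> justified_evals D h c xs v.
Proof.
  unfold justified. destruct (entry_proj h 1 c xs v) as [-> [-> [-> [-> ->]]]].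
  intuition discriminate.
Qed.

Lemma entry_ge_v h t c xs v : v <= entry h t c xs v.
Proof.
  unfold entry. pose proof (pair_ge h (pair t (pair c (pair xs v)))).
  pose proof (pair_ge t (pair c (pair xs v))).
  pose proof (pair_ge c (pair xs v)). pose proof (pair_ge xs v). lia.
Qed.

Lemma premise_mono (D D' : set) h h' t c xs v : (forall x, D x -> D' x) -> h <= h' ->
  premise D h t c xs v -> premise D' h' t c xs v.
Proof. intros H Hh [k [Hk Dk]]. exists k; split; auto; lia. Qed.

(** Premises occur only positively, so a justification survives enlarging the certificate; the
    oracle matters only at the single point that the entry queries. This mediates between
    certificates with and without bounds. *)
Lemma justified_mono (O Dm Bd D O' Dm' Bd' D' : set) x :
  (forall x, D x -> D' x) ->
  (forall h t c xs v, D (entry h t c xs v) -> Bd' v) ->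
  (Dm (lhd (ent_xs x)) -> Dm' (lhd (ent_xs x)) /\
     (O (lhd (ent_xs x)) <-> O' (lhd (ent_xs x)))) ->
  justified O Dm Bd D x -> justified O' Dm' Bd' D' x.
Proof.
  intros HD HB HO [H0 H1].
  assert (PM : forall h t c xs v, premise D h t c xs v -> premise D' h t c xs v).
  { intros; eapply premise_mono; eauto. }
  assert (PB : forall h t c xs v, premise D h t c xs v -> Bd' v).
  { intros h t c xs v [h' [_ G]]; eauto. }
  split; intros E.
  - specialize (H0 E). unfold justified_eval in *.
    destruct H0 as [H|[H|[H|[[H [h1 h2]]|[[H [ys [_ [h1 h2]]]]|[[H [h1 [h2 h3]]]|
      [[H [h1 [h2 [w [_ [h3 h4]]]]]]|[H [h1 h2]]]]]]]]].
    + left; auto.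
    + right; left; auto.
    + right; right; left; auto.
    + right; right; right; left. destruct (HO h1) as [K1 K2]. tauto.
    + right; right; right; right; left. split; auto. exists ys; eauto 6.
    + do 5 right; left; auto.
    + do 6 right; left. split; auto. split; auto. split; auto. exists w; eauto 6.
    + do 7 right. split; auto. split; auto. intros z Hz.
      destruct (h2 z Hz) as [w [_ [h3 h4]]]. exists w; eauto 6.
  - specialize (H1 E). unfold justified_evals in *.
    destruct H1 as [H|[H [h1 [h2 h3]]]]; [left; auto|right; auto].
Qed.

Definition AllSet : set := fun _ => True.

(** Induction on the height, which prevents entries from justifying each other in a circle. *)
Lemma certificate_sound X (D : set) :
  (forall x, D x -> justified X AllSet AllSet D x) ->
  forall h c xs v,
    (D (entry h 0 c (lcode xs) v) -> eval X (decode c) xs v) /\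
    (D (entry h 1 c (lcode xs) v) -> exists vs, v = lcode vs /\ evals X (decodes c) xs vs).
Proof.
  intros HD. induction h as [h IH] using lt_wf_ind. intros c xs v.
  assert (IH0 : forall c xs v, premise D h 0 c (lcode xs) v -> eval X (decode c) xs v).
  { intros c' xs' v' [h' [Hh' G]]. apply (IH h' Hh'); auto. }
  assert (IH1 : forall c xs v, premise D h 1 c (lcode xs) v ->
             exists vs, v = lcode vs /\ evals X (decodes c) xs vs).
  { intros c' xs' v' [h' [Hh' G]]. apply (IH h' Hh'); auto. }
  split; intros G; apply HD in G.
  - rewrite justified_entry0 in G. unfold justified_eval in G. rewrite decode_eq.
    destruct G as [[H ->]|[[H ->]|[[H ->]|[[H [_ h2]]|[[H [ys [_ [h1 h2]]]]|[[H [h1 [h2 h3]]]|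
      [[H [h1 [h2 [w [_ [h3 h4]]]]]]|[H [h1 h2]]]]]]]]].
    + destruct (p1 c) as [|[|[|[|[|[|[|?]]]]]]]; try lia; constructor.
    + rewrite H, lhd_lcode. constructor.
    + rewrite H, nth_lcode. constructor.
    + rewrite H. rewrite lhd_lcode in h2. destruct h2 as [[h2 ->]|[h2 ->]]; constructor; auto.
    + rewrite H. apply IH1 in h1. destruct h1 as [vs [-> h1]].
      econstructor; eauto.
    + rewrite H. destruct xs as [|x xs]; [tauto|].
      rewrite lhd_lcode in h2. simpl in h2. subst x.
      rewrite ltl_lcode in h3. constructor; auto.
    + rewrite H. destruct xs as [|x xs]; [tauto|].
      rewrite lhd_lcode in *. rewrite ltl_lcode in *.
      simpl hd in *; simpl tl in *.
      destruct x as [|x]; [tauto|]. simpl Nat.pred in *.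
      apply (IH0 c (x :: xs)) in h3. apply (IH0 _ (x :: w :: xs)) in h4.
      rewrite decode_eq, H in h3. econstructor; eauto.
    + rewrite H. constructor.
      * apply (IH0 _ (v :: xs)); auto.
      * intros z Hz. destruct (h2 z Hz) as [[|w] [_ [h3 h4]]]; [tauto|].
        exists w. apply (IH0 _ (z :: xs)); auto.
  - rewrite justified_entry1 in G. unfold justified_evals in G.
    destruct G as [[-> ->]|[H [h1 [h2 h3]]]].
    + exists []. split; constructor.
    + destruct c as [|c]; [tauto|]. destruct (lcode_onto v) as [vs <-].
      destruct vs as [|v vs]; [tauto|]. rewrite decodes_S.
      rewrite lhd_lcode in h2. rewrite ltl_lcode in h3.
      apply IH1 in h3. destruct h3 as [vs' [E h3]]. simpl in E.
      exists (v :: vs'). split; [simpl; congruence|].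
      constructor; auto.
Qed.

Definition certifies (X : set) (l : list nat) : Prop :=
  forall x, In x l -> justified X AllSet AllSet (fun x => In x l) x.

Lemma certifies_app X l l' : certifies X l -> certifies X l' -> certifies X (l ++ l').
Proof.
  intros H H' x Hx. apply in_app_or in Hx. destruct Hx as [Hx|Hx];
    [apply H in Hx|apply H' in Hx]; revert Hx; apply justified_mono;
    unfold AllSet; try tauto; intros; apply in_or_app; auto.
Qed.

Lemma certifies_cons X l x : certifies X l ->
  justified X AllSet AllSet (fun x => In x l) x -> certifies X (x :: l).
Proof.
  intros H H' y Hy. assert (G : justified X AllSet AllSet (fun x => In x l) y).
  { destruct Hy as [<-|Hy]; auto. }
  revert G; apply justified_mono; unfold AllSet; try tauto. intros; right; auto.
Qed.

Lemma certificate_complete X c xs v : eval X c xs v ->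
  forall a, decode a = c -> exists l h, certifies X l /\ In (entry h 0 a (lcode xs) v) l.
Proof.
  revert c xs v.
  assert (Base : forall a xs v,
    justified_eval X AllSet AllSet (fun x => In x []) 0 a (lcode xs) v ->
    exists l h, certifies X l /\ In (entry h 0 a (lcode xs) v) l).
  { intros a xs v H. exists [entry 0 0 a (lcode xs) v], 0. split; [|left; auto].
    apply certifies_cons; [intros x []|]. apply justified_entry0; auto. }
  assert (Pr : forall (l l' : list nat) h h' t c xs v, In (entry h t c xs v) l ->
     h < h' -> (forall x, In x l -> In x l') -> premise (fun x => In x l') h' t c xs v).
  { intros l l' h h' t c xs v H Hh G. exists h; auto. }
  apply (eval_strong_ind X
    (fun c xs v => forall a, decode a = c ->
       exists l h, certifies X l /\ In (entry h 0 a (lcode xs) v) l)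
    (fun gs xs vs => forall a, decodes a = gs ->
       exists l h, certifies X l /\ In (entry h 1 a (lcode xs) (lcode vs)) l)).
  - intros xs a E. apply Base. left. split; auto. rewrite decode_eq in E.
    destruct (p1 a) as [|[|[|[|[|[|[|?]]]]]]]; try discriminate; lia.
  - intros xs a E. apply Base. right; left. rewrite lhd_lcode. split; auto.
    rewrite decode_eq in E.
    destruct (p1 a) as [|[|[|[|[|[|[|?]]]]]]]; try discriminate; lia.
  - intros i xs a E. apply Base. do 2 right; left. rewrite decode_eq in E.
    destruct (p1 a) as [|[|[|[|[|[|[|?]]]]]]]; try discriminate.
    injection E as <-. rewrite nth_lcode. auto.
  - intros xs H a E. apply Base. do 3 right; left. rewrite lhd_lcode, decode_eq in *.
    destruct (p1 a) as [|[|[|[|[|[|[|?]]]]]]]; try discriminate.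
    unfold AllSet; auto.
  - intros xs H a E. apply Base. do 3 right; left. rewrite lhd_lcode, decode_eq in *.
    destruct (p1 a) as [|[|[|[|[|[|[|?]]]]]]]; try discriminate.
    unfold AllSet; auto.
  - intros f gs xs ys v H1 H2 a E. rewrite decode_eq in E.
    destruct (p1 a) as [|[|[|[|[|[|[|?]]]]]]] eqn:T; try discriminate.
    injection E as E1 E2. destruct (H1 _ E2) as [l1 [h1 [C1 I1]]].
    destruct (H2 _ E1) as [l2 [h2 [C2 I2]]].
    exists (entry (S (h1 + h2)) 0 a (lcode xs) v :: l1 ++ l2), (S (h1 + h2)).
    split; [|left; auto]. apply certifies_cons; [apply certifies_app; auto|].
    apply justified_entry0. do 4 right; left. split; auto.
    exists (lcode ys). split; [exact I|]. split; eapply Pr; eauto; try lia;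
      intros; apply in_or_app; auto.
  - intros f g xs v H a E. rewrite decode_eq in E.
    destruct (p1 a) as [|[|[|[|[|[|[|?]]]]]]] eqn:T; try discriminate.
    injection E as E1 E2. destruct (H _ E1) as [l1 [h1 [C1 I1]]].
    exists (entry (S h1) 0 a (lcode (0 :: xs)) v :: l1), (S h1).
    split; [|left; auto]. apply certifies_cons; auto.
    apply justified_entry0. do 5 right; left. rewrite lhd_lcode, ltl_lcode.
    repeat split; auto; [discriminate|]. eapply Pr; eauto.
  - intros f g y xs w v H1 H2 a E. pose proof E as E0. rewrite decode_eq in E.
    destruct (p1 a) as [|[|[|[|[|[|[|?]]]]]]] eqn:T; try discriminate.
    injection E as E1 E2. destruct (H1 _ E0) as [l1 [h1 [C1 I1]]].
    destruct (H2 _ E2) as [l2 [h2 [C2 I2]]].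
    exists (entry (S (h1 + h2)) 0 a (lcode (S y :: xs)) v :: l1 ++ l2), (S (h1 + h2)).
    split; [|left; auto]. apply certifies_cons; [apply certifies_app; auto|].
    apply justified_entry0. do 6 right; left. rewrite lhd_lcode, ltl_lcode.
    simpl hd; simpl tl; simpl Nat.pred.
    repeat split; auto; try discriminate. exists w. split; [exact I|].
    split; eapply Pr; eauto; try lia; intros; apply in_or_app; auto.
  - intros f xs y H1 H2 a E. rewrite decode_eq in E.
    destruct (p1 a) as [|[|[|[|[|[|[|?]]]]]]] eqn:T; try discriminate.
    injection E as E1. destruct (H1 _ E1) as [l1 [h1 [C1 I1]]].
    (* The certificates for all [z < y] are merged into one, with a common bound on their
       heights. *)
    assert (L : exists l2 h2, certifies X l2 /\ forall z, z < y -> exists w h, h < h2 /\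
                 In (entry h 0 (p2 a) (lcode (z :: xs)) (S w)) l2).
    { clear H1 I1. induction y as [|y IH].
      - exists [], 0. split; [intros x []|intros; lia].
      - destruct IH as [l2 [h2 [C2 I2]]]; [intros; apply H2; lia|].
        destruct (H2 y) as [w Hw]; [lia|]. destruct (Hw _ E1) as [l3 [h3 [C3 I3]]].
        exists (l2 ++ l3), (S (h2 + h3)). split; [apply certifies_app; auto|].
        intros z Hz. destruct (Nat.eq_dec z y) as [->|N].
        + exists w, h3. split; [lia|apply in_or_app; auto].
        + destruct (I2 z) as [w' [h [Hh I4]]]; [lia|].
          exists w', h. split; [lia|apply in_or_app; auto]. }
    destruct L as [l2 [h2 [C2 I2]]].
    exists (entry (S (h1 + h2)) 0 a (lcode xs) y :: l1 ++ l2), (S (h1 + h2)).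
    split; [|left; auto]. apply certifies_cons; [apply certifies_app; auto|].
    apply justified_entry0. do 7 right. split; auto. split.
    + apply (Pr l1 _ h1 _ _ _ (lcode (y :: xs))); auto; [lia|]. intros; apply in_or_app; auto.
    + intros z Hz. destruct (I2 z Hz) as [w [h [Hh I4]]]. exists (S w).
      split; [exact I|]. split; [discriminate|].
      apply (Pr l2 _ h _ _ _ (lcode (z :: xs))); auto; [lia|]. intros; apply in_or_app; auto.
  - intros xs a E. exists [entry 0 1 a (lcode xs) 0], 0. split; [|left; auto].
    apply certifies_cons; [intros x []|]. apply justified_entry1. left; split; auto.
    destruct a; auto. rewrite decodes_S in E; discriminate.
  - intros g gs xs v vs H1 H2 a E. destruct a as [|a]; [discriminate|].
    rewrite decodes_S in E. injection E as E1 E2.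
    destruct (H1 _ E1) as [l1 [h1 [C1 I1]]]. destruct (H2 _ E2) as [l2 [h2 [C2 I2]]].
    exists (entry (S (h1 + h2)) 1 (S a) (lcode xs) (lcode (v :: vs)) :: l1 ++ l2), (S (h1 + h2)).
    split; [|left; auto]. apply certifies_cons; [apply certifies_app; auto|].
    apply justified_entry1. right. split; [discriminate|]. split; [discriminate|].
    rewrite lhd_lcode, ltl_lcode.
    split; eapply Pr; eauto; try lia; intros; apply in_or_app; auto.
Qed.

(* [halts s e n]: the computation halts within [slen s] steps, querying the
   oracle only below [slen s]. *)
Definition halts (s e n : nat) : Prop :=
  exists D, D <= slen s /\
    ((forall x, x < slen D -> sset D x ->
        justified (sset s) (fun i => i < slen s) (fun i => i < slen D) (sset D) x) /\
     exists h, h < slen D /\ exists v, v < slen D /\ sset D (entry h 0 e (S (pair n 0)) v)).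

Lemma list_bound (l : list nat) : exists N, forall x, In x l -> x < N.
Proof.
  induction l as [|x l [N H]]; [exists 0; intros x []|].
  exists (S (N + x)). intros y [<-|Hy]; [lia|]. specialize (H y Hy). lia.
Qed.

Lemma univ_halts X e n : univ X e n <-> exists k, halts (pre X k) e n.
Proof.
  split.
  - intros [v Hv]. destruct (certificate_complete _ _ _ _ Hv e eq_refl) as [l [h [C I]]].
    destruct (list_bound l) as [N HN].
    set (D := pre (fun x => In x l) N).
    assert (SD : forall x, sset D x <-> In x l).
    { intros x. unfold D. rewrite sset_pre. split; [tauto|]. intros; split; auto. }
    assert (LD : slen D = N) by apply slen_pre.
    (* The code of the certificate also serves as the length of the oracle segment: it exceeds every
       entry, hence every query. *)
    exists D, D. rewrite slen_pre. split; auto. rewrite LD. split.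
    + intros x Hx Dx. apply SD in Dx. apply C in Dx. revert Dx.
      apply justified_mono.
      * intros; apply SD; auto.
      * intros h' t c xs v' K. apply HN in K. pose proof (entry_ge_v h' t c xs v'). lia.
      * intros _. assert (lhd (ent_xs x) < D).
        { pose proof (lcode_hd_le (ent_xs x)). unfold ent_xs in *.
          pose proof (p1_le (p2 (p2 (p2 x)))). pose proof (p2_le (p2 (p2 x))).
          pose proof (p2_le (p2 x)). pose proof (p2_le x).
          pose proof (slen_le D). lia. }
        rewrite sset_pre. tauto.
    + exists h. pose proof (HN _ I) as B.
      pose proof (entry_ge_v h 0 e (lcode [n]) v).
      pose proof (pair_ge h (pair 0 (pair e (pair (lcode [n]) v)))).
      unfold entry in *. split; [lia|]. exists v. split; [lia|].
      apply SD; auto.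
  - intros [k [D [HD [HJ [h [_ [v [_ HE]]]]]]]]. exists v.
    apply (fun H => proj1 (certificate_sound X (sset D) H h e [n] v) HE).
    intros x Dx. generalize (HJ x (sset_lt _ _ Dx) Dx).
    apply justified_mono; unfold AllSet; auto.
    rewrite slen_pre. intros L. rewrite sset_pre. tauto.
Qed.

Lemma dec_premise X D h t c xs v : comp X D -> comp X h -> comp X t -> comp X c ->
  comp X xs -> comp X v ->
  dec X (fun n => premise (sset (D n)) (h n) (t n) (c n) (xs n) (v n)).
Proof.
  intros. unfold premise, entry.
  apply (dec_bex X h (fun n h' => sset (D n)
     (pair h' (pair (t n) (pair (c n) (pair (xs n) (v n))))))); auto.
  apply dec_sset; [apply (comp_comp X D); cmp|].
  apply comp_pair; [cmp|].
  repeat apply comp_pair; [apply (comp_comp X t)|apply (comp_comp X c)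
    |apply (comp_comp X xs)|apply (comp_comp X v)]; cmp.
Qed.
#[export] Hint Resolve dec_premise : cdb.

Lemma dec_halts' X : dec X (fun z => halts (p1 z) (p1 (p2 z)) (p2 (p2 z))).
Proof.
  unfold halts, justified, justified_eval, justified_evals, ent_c, ent_xs, ent_v, entry.
  cmp.
Qed.

Lemma dec_halts X s e n : comp X s -> comp X e -> comp X n ->
  dec X (fun z => halts (s z) (e z) (n z)).
Proof. intros. apply (dec_app3 X halts); auto. apply dec_halts'. Qed.
#[export] Hint Resolve dec_halts : cdb.

Lemma re_univ X : re X (fun z => univ X (p1 z) (p2 z)).
Proof.
  eapply re_ext; [|intros z; symmetry; apply univ_halts].
  apply re_ex. apply re_dec. apply dec_halts; cmp. apply comp_pre1; cmp. apply dec_oracle.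
Qed.

Lemma dec_jump X : dec (jump X) X.
Proof. apply re_dec_jump, re_dec, dec_oracle. Qed.

Lemma co_re_dec_jump X R : re X (fun n => ~ R n) -> dec (jump X) R.
Proof.
  intros H. eapply dec_ext; [apply dec_not, re_dec_jump, H|].
  intros n; cbv beta. split; [apply NNPP|tauto].
Qed.

(** * Trees, PA degrees and the low basis theorem *)

Definition prefix_closed (T : set) : Prop :=
  forall Y j k, j <= k -> T (pre Y k) -> T (pre Y j).

Lemma prefix_closed_IsTree T : IsTree T <-> prefix_closed T.
Proof.
  split.
  - intros H Y j k Hjk.
    assert (E : forall i, pre Y i = code_str (init_seg (char_fun Y) i)).
    { intros i. rewrite pre_init_seg. apply pre_ext. intros; symmetry; apply as_set_char. }
    rewrite !E. replace k with (j + (k - j)) by lia.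
    unfold init_seg. rewrite seq_app, map_app. apply H.
  - intros H s t. rewrite !code_str_pre. intros G.
    replace (pre _ (length s)) with
      (pre (fun i => nth i (s ++ t) false = true) (length s)).
    + revert G. apply H. rewrite length_app; lia.
    + apply pre_ext. intros i Hi. rewrite app_nth1 by auto. tauto.
Qed.

(** A PA set finds members of nonempty [Pi^0_1(X)] classes. [Bad] is only c.e., so the decidable
    tree keeps a string as long as none of its initial segments has been enumerated within as many
    stages as the string is long. *)
Lemma PA_path Q X Bad : PA_over Q X -> re X Bad ->
  (forall k, exists Y : set, forall i, i <= k -> ~ Bad (pre Y i)) ->
  exists Y : set, dec Q Y /\ forall k, ~ Bad (pre Y k).
Proof.
  intros HPA [S [HS E]] Hex.
  set (T := fun s => forall i, i <= slen s -> forall w, w <= slen s ->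
              ~ S (pre (sset s) i) w).
  assert (ET : forall Y k, T (pre Y k) <->
             forall i, i <= k -> forall w, w <= k -> ~ S (pre Y i) w).
  { intros Y k. unfold T. rewrite slen_pre. split; intros H i Hi w Hw;
      specialize (H i Hi w Hw); rewrite pre_pre in *; auto. }
  destruct (HPA T) as [f [Hf Df]].
  - apply prefix_closed_IsTree. intros Y j k Hjk. rewrite !ET.
    intros H i Hi w Hw. apply H; lia.
  - intros m. destruct (Hex m) as [Y HY]. exists (pre Y m). split.
    + pose proof (slen_le (pre Y m)). rewrite slen_pre in H. auto.
    + apply ET. intros i Hi w _ Sw. apply (HY i Hi). apply E; eauto.
  - unfold T.
    apply (dec_ball_le X slen (fun s i => forall w, w <= slen s -> ~ S (pre (sset s) i) w)); [cmp|].
    apply (dec_ball_le X (fun z => slen (p1 z))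
      (fun z w => ~ S (pre (sset (p1 z)) (p2 z)) w)); [cmp|].
    apply dec_not. apply (dec_app2 X S); cmp.
  - exists (as_set f). split; auto. intros k B. apply E in B. destruct B as [w Hw].
    specialize (Hf (k + w)). rewrite pre_init_seg, ET in Hf.
    apply (Hf k ltac:(lia) w ltac:(lia) Hw).
Qed.

(** The class whose only member is [X] is itself a [Pi^0_1(X)] class. *)
Lemma PA_dec Q X : PA_over Q X -> dec Q X.
Proof.
  intros H. destruct (PA_path Q X (fun s => s <> pre X (slen s)) H) as [Y [HY E]].
  - apply re_dec. apply dec_not, dec_eq; [cmp|]. apply comp_pre1; [apply dec_oracle|cmp].
  - intros k. exists X. intros i _ G. rewrite slen_pre in G. auto.
  - eapply dec_ext; [apply HY|]. intros n.
    specialize (E (S n)). apply NNPP in E. rewrite slen_pre in E.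
    pose proof (sset_pre Y (S n) n) as A. rewrite E, sset_pre in A.
    assert (n < S n) by lia. tauto.
Qed.

Section LowBasis.
Variables (X T : set).
Hypothesis T_dec : dec X T.
Hypothesis T_closed : prefix_closed T.
Hypothesis T_inf : forall k, exists Y, T (pre Y k).

(* Requirement [pair 0 e] asks whether [e] enters the jump, requirement
   [pair 1 i] whether [i] is an element. *)
Let met (s j : nat) : Prop :=
  (p1 j = 0 /\ exists k, k <= slen s /\ halts (pre (sset s) k) (p2 j) (p2 j)) \/
  (p1 j <> 0 /\ sset s (p2 j)).

Let met_mono Y k k' j : k <= k' -> met (pre Y k) j -> met (pre Y k') j.
Proof.
  intros Hk [[H [i [Hi G]]]|[H G]]; [left|right]; split; auto.
  - rewrite slen_pre in *. exists i. rewrite pre_pre in * by lia. split; auto; lia.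
  - rewrite sset_pre in *. split; [lia|tauto].
Qed.

Let avoids (d : set) (j s : nat) : Prop := T s /\ forall i, i < j -> d i -> ~ met s i.

(** Can requirement [p1 z] be avoided forever, given the earlier decisions coded by [p2 z]? Only
    finitely many strings have a given length, so this is a [Pi^0_1(X)] question and the jump
    answers it. *)
Let ans (z : nat) : Prop := forall k, exists Y,
  avoids (sset (p2 z)) (p1 z) (pre Y k) /\ ~ met (pre Y k) (p1 z).

Let ans_dec : dec (jump X) ans.
Proof.
  apply co_re_dec_jump.
  apply (re_ext X (fun z => exists k, forall v, v < 2 ^ (S k) -> slen v = k ->
     ~ (avoids (sset (p2 z)) (p1 z) v /\ ~ met v (p1 z)))).
  - apply re_ex. apply re_dec. unfold avoids, met.
    apply (dec_ball X (fun z => 2 ^ S (p2 z)) (fun z v => slen v = p2 z ->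
       ~ ((T v /\ (forall i, i < p1 (p1 z) -> sset (p2 (p1 z)) i -> _)) /\ ~ _))); [cmp|].
    apply dec_imp; [cmp|]. apply dec_not, dec_and; [apply dec_and|]; [|cmp|cmp].
    apply (dec_app X T); cmp.
  - intros z. split.
    + intros [k H] A. destruct (A k) as [Y HY]. apply (H (pre Y k)); auto.
      * pose proof (pre_bound Y k). lia.
      * apply slen_pre.
    + intros N. apply not_all_ex_not in N. destruct N as [k N]. exists k.
      intros v _ L H. apply N. exists (sset v). subst k. rewrite pre_sset. auto.
Qed.

(** Course-of-values recursion: each decision depends on all earlier ones, which are carried along
    as a string. *)
Let dstr (j : nat) : nat := primrec 0 (fun i r => r + 2 ^ i * S (chi ans (pair i r))) j.

Let d : set := fun j => ans (pair j (dstr j)).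

Let dstr_pre j : dstr j = pre d j.
Proof. induction j as [|j IH]; [reflexivity|]. rewrite pre_S, <- IH. reflexivity. Qed.

Let d_dec : dec (jump X) d.
Proof.
  apply (dec_app _ ans); [apply ans_dec|]. apply comp_pair; [cmp|].
  apply (comp_primrec _ _ _ (fun _ i r => r + 2 ^ i * S (chi ans (pair i r)))); cmp.
  apply comp_add; [cmp|]. apply comp_mul; [cmp|]. apply comp_succ.
  apply (comp_comp _ (chi ans)); [|cmp]. apply dec_chi, ans_dec.
Qed.

Let d_spec j : d j <-> forall k, exists Y, avoids d j (pre Y k) /\ ~ met (pre Y k) j.
Proof.
  unfold d at 1, ans. rewrite p1_pair, p2_pair, dstr_pre.
  assert (G : forall s, avoids (sset (pre d j)) j s <-> avoids d j s).
  { intros s. unfold avoids. split; intros [H1 H2]; split; auto; intros i Hi di;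
      apply H2; auto; rewrite sset_pre in *; tauto. }
  split; intros H k; destruct (H k) as [Y [H1 H2]]; exists Y; split; auto; apply G; auto.
Qed.

Let avoids_le j j' s : j <= j' -> avoids d j' s -> avoids d j s.
Proof. intros Hj [H1 H2]; split; auto. intros i Hi; apply H2; lia. Qed.

Let avoids_closed j Y k k' : k <= k' -> avoids d j (pre Y k') -> avoids d j (pre Y k).
Proof.
  intros Hk [H1 H2]; split; [eapply T_closed; eauto|].
  intros i Hi di M. apply (H2 i Hi di). eapply met_mono; eauto.
Qed.

Let avoids_inf j : forall k, exists Y, avoids d j (pre Y k).
Proof.
  induction j as [|j IH]; intros k.
  - destruct (T_inf k) as [Y HY]. exists Y; split; auto. intros; lia.
  - destruct (classic (d j)) as [h|h].
    + rewrite d_spec in h. destruct (h k) as [Y [[H1 H2] H3]]. exists Y. split; auto.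
      intros i Hi. destruct (Nat.eq_dec i j) as [->|N]; auto. apply H2; lia.
    + destruct (IH k) as [Y [H1 H2]]. exists Y. split; auto.
      intros i Hi di. destruct (Nat.eq_dec i j) as [->|N]; [tauto|]. apply H2; auto; lia.
Qed.

Let forced_met j : ~ d j -> exists k0, forall Y k, k0 <= k ->
  avoids d j (pre Y k) -> met (pre Y k) j.
Proof.
  intros H. rewrite d_spec in H. apply not_all_ex_not in H. destruct H as [k0 H].
  exists k0. intros Y k Hk A. apply (met_mono Y k0); auto.
  apply NNPP. intros N. apply H. exists Y. split; auto. eapply avoids_closed; eauto.
Qed.

Let decided j : exists k0, forall Y k, k0 <= k -> avoids d j (pre Y k) ->
  forall i, i < j -> (met (pre Y k) i <-> ~ d i).
Proof.
  induction j as [|j [k0 IH]]; [exists 0; intros; lia|].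
  assert (G : exists k1, forall Y k, k1 <= k -> avoids d (S j) (pre Y k) ->
     (met (pre Y k) j <-> ~ d j)).
  { destruct (classic (d j)) as [h|h].
    - exists 0. intros Y k _ [_ A]. split; [|tauto]. intros M. destruct (A j); auto.
    - destruct (forced_met j h) as [k1 H]. exists k1. intros Y k Hk A.
      split; auto. intros _. apply H; auto. eapply avoids_le; [|eauto]; lia. }
  destruct G as [k1 G]. exists (k0 + k1). intros Y k Hk A i Hi.
  destruct (Nat.eq_dec i j) as [->|N].
  - apply G; auto; lia.
  - apply IH; try lia. eapply avoids_le; [|eauto]; lia.
Qed.

(** The path needs no separate construction: [i] enters exactly when the decisions have made its
    omission impossible. *)
Let W : set := fun i => ~ d (pair 1 i).

Let approx L j : exists Y k, L <= k /\ avoids d j (pre Y k) /\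
  (forall i, i < L -> (Y i <-> W i)) /\ forall i, i < j -> (met (pre Y k) i <-> ~ d i).
Proof.
  (* [pair 1 L] exceeds [pair 1 i] for all [i < L], so the bits of [Y] below [L] are already
     decided. *)
  set (j' := j + pair 1 L). destruct (decided j') as [k0 H].
  destruct (avoids_inf j' (k0 + L)) as [Y HY]. exists Y, (k0 + L).
  specialize (H Y (k0 + L) ltac:(lia) HY).
  split; [lia|]. split; [eapply avoids_le; [|eauto]; unfold j'; lia|]. split.
  - intros i Hi. unfold W. rewrite <- H.
    + unfold met. rewrite p1_pair, p2_pair, sset_pre.
      split; [intros; right; repeat split; auto; lia|]. intros [[K _]|K]; [discriminate|tauto].
    + unfold j'. pose proof (pair_lt_r 1 i L Hi). lia.
  - intros i Hi. apply H. unfold j'; lia.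
Qed.

Theorem low_basis : exists W, (forall k, T (pre W k)) /\ dec (jump X) (jump W).
Proof.
  exists W. split.
  - intros k. destruct (approx k 0) as [Y [k' [Hk [[A _] [E _]]]]].
    rewrite <- (pre_ext Y W k); auto. eapply T_closed; eauto.
  - eapply dec_ext; [apply dec_not, (dec_app _ d (fun e => pair 0 e) d_dec); cmp|].
    intros e; cbv beta. change (jump W e) with (univ W e e). rewrite univ_halts. split.
    + intros h. destruct (forced_met _ h) as [k0 H].
      destruct (approx k0 (pair 0 e)) as [Y [k [Hk [A [E _]]]]].
      specialize (H Y k0 ltac:(auto) (avoids_closed _ _ _ _ Hk A)).
      unfold met in H. rewrite p1_pair, p2_pair, slen_pre in H.
      destruct H as [[_ [i [Hi H]]]|[H _]]; [|tauto].
      exists i. rewrite pre_pre in H by auto. rewrite <- (pre_ext Y W i); auto.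
      intros i' Hi'; apply E; lia.
    + intros [k H]. destruct (approx k (S (pair 0 e))) as [Y [k' [Hk [A [E M]]]]].
      apply M; [lia|]. left. rewrite p1_pair, p2_pair, slen_pre. split; auto.
      exists k. split; auto. rewrite pre_pre, (pre_ext Y W) by auto. auto.
Qed.
End LowBasis.

(** * Coded Scott sets *)

Definition col (W : set) (a : nat) : set := fun i => W (pair a i).

Definition join_cols (Z W : set) (b : nat) : set := fun x =>
  (p1 x = 0 /\ Z (p2 x)) \/ (p1 x <> 0 /\ p1 (p2 x) < b /\ W (p2 x)).

Lemma join_cols_Z Z W b : dec (join_cols Z W b) Z.
Proof.
  eapply dec_ext; [apply (dec_app _ (join_cols Z W b) (pair 0)); [apply dec_oracle|cmp]|].
  intros n; unfold join_cols. rewrite p1_pair, p2_pair. intuition lia.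
Qed.

Lemma join_cols_col Z W b : dec (join_cols Z W b) (fun z => p1 z < b /\ W z).
Proof.
  eapply dec_ext; [apply (dec_app _ (join_cols Z W b) (pair 1)); [apply dec_oracle|cmp]|].
  intros n; unfold join_cols. rewrite p1_pair, p2_pair. intuition lia.
Qed.

(* The columns of [W] form a Scott set relative to [Z]: every nonempty
   [Pi^0_1] class relative to [Z] and the columns below [b] has a column of [W] as a
   member. *)
Definition scott (Z W : set) : Prop := forall b Bad, re (join_cols Z W b) Bad ->
  (forall t, exists y : set, forall i, i <= t -> ~ Bad (pre y i)) ->
  exists a, forall i, ~ Bad (pre (col W a) i).

Lemma scott_PA Z W : scott Z W -> PA_over W Z.
Proof.
  intros H T HT Tinf TZ. apply prefix_closed_IsTree in HT.
  destruct (H 0 (fun s => ~ T s)) as [a Ha].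
  - apply re_dec, dec_not. apply dec_trans with Z; auto. apply join_cols_Z.
  (* A string code of at least [2 ^ S t] has length greater than [t], so an infinite tree contains
     strings of every length. *)
  - intros t. destruct (Tinf (2 ^ S t)) as [s [Hs Ts]]. exists (sset s).
    intros i Hi N. apply N. apply HT with (slen s); [|rewrite pre_sset; auto].
    apply Nat.le_trans with t; auto. unfold slen.
    assert (S t <= Nat.log2 (S s)) by (apply Nat.log2_le_pow2; lia). lia.
  - exists (char_fun (col W a)). split.
    + intros k. rewrite pre_init_seg. apply NNPP. rewrite (pre_ext _ (col W a)).
      * apply Ha.
      * intros i _; apply as_set_char.
    + eapply dec_ext; [apply (dec_app W W (pair a)); [apply dec_oracle|cmp]|].
      intros n; cbv beta. rewrite as_set_char. reflexivity.
Qed.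

Section Scott.
Variable Z : set.

(* Column [pair e b] follows the tree with index [e] relative to [Z] and the
   columns below [b]. *)
Let kill (W : set) (a t : nat) (y : set) : Prop :=
  exists i, i <= t /\ exists k, k <= t /\
    halts (pre (join_cols Z W (p2 a)) k) (p1 a) (pre y i).

(** Most indices define empty classes or none of interest, and emptiness is not decidable. The
    column must therefore survive stage [t] only if some set does; the bound on [v] covers all
    strings of length [t]. *)
Let good (W : set) (a t : nat) : Prop :=
  ~ kill W a t (col W a) \/ forall v, v < 2 ^ (S t) -> kill W a t (sset v).

(** The oracle for column [a] consults only columns below [p2 a <= a], so columns can be filled one
    after another. *)
Let kill_ext W W' a t (y y' : set) :
  (forall x, x < t -> p1 x < a -> (W x <-> W' x)) -> (forall i, i < t -> (y i <-> y' i)) ->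
  kill W a t y -> kill W' a t y'.
Proof.
  intros HW Hy [i [Hi [k [Hk H]]]]. exists i; split; auto. exists k; split; auto.
  rewrite <- (pre_ext y y' i) by (intros; apply Hy; lia).
  rewrite <- (pre_ext (join_cols Z W (p2 a)) (join_cols Z W' (p2 a)) k); auto.
  intros x Hx. unfold join_cols. pose proof (p2_le x). pose proof (p2_le a).
  split; intros [K|[K1 [K2 K3]]]; auto; right; repeat split; auto; apply HW; auto; lia.
Qed.

Let kill_mono W a t t' y : t <= t' -> kill W a t y -> kill W a t' y.
Proof.
  intros Ht [i [Hi [k [Hk H]]]]. exists i; split; [lia|]. exists k; split; auto; lia.
Qed.

Let good_all W a t : good W a t <-> ~ kill W a t (col W a) \/ forall y, kill W a t y.
Proof.
  unfold good. split; intros [H|H]; auto; right.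
  intros y. apply kill_ext with (W := W) (y := sset (pre y t)); [tauto| |].
  - intros i Hi. rewrite sset_pre. tauto.
  - apply H. pose proof (pre_bound y t). lia.
Qed.

Let good_ext W W' a t :
  (forall x, x < pair a t -> p1 x <= a -> (W x <-> W' x)) -> good W a t -> good W' a t.
Proof.
  intros H. assert (HW : forall x, x < t -> p1 x < a -> (W x <-> W' x)).
  { intros x Hx Hxa. apply H; [|lia]. pose proof (pair_ge a t). lia. }
  assert (HC : forall i, i < t -> (col W a i <-> col W' a i)).
  { intros i Hi. apply H; [apply pair_lt_r; auto|rewrite p1_pair; auto]. }
  rewrite !good_all. intros [G|G]; [left|right].
  - intros K. apply G. revert K. apply kill_ext; intros; symmetry; auto.
  - intros y. apply (kill_ext W W' a t y y); auto. tauto.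
Qed.

(** Keep a set that survives as many stages up to [L] as possible: at a stage that it does not
    survive, every set is killed. *)
Let good_column W a L : exists y : set, forall t, t <= L ->
  ~ kill W a t y \/ forall y', kill W a t y'.
Proof.
  induction L as [|L [y IH]].
  - destruct (classic (exists y, ~ kill W a 0 y)) as [[y H]|N].
    + exists y. intros t Ht. replace t with 0 by lia. auto.
    + exists W. intros t Ht. replace t with 0 by lia. right. intros y'.
      apply NNPP. intros K. apply N; eauto.
  - destruct (classic (exists y, ~ kill W a (S L) y)) as [[y' H]|N].
    + exists y'. intros t Ht. left. intros K. apply H. revert K. apply kill_mono; auto.
    + exists y. intros t Ht. destruct (Nat.eq_dec t (S L)) as [->|N']; [|apply IH; lia].
      right. intros y'. apply NNPP. intros K. apply N; eauto.
Qed.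

Let good_ex L a : exists W, forall a', a' < a -> forall t, t <= L -> good W a' t.
Proof.
  induction a as [|a [W IH]]; [exists Z; intros; lia|].
  destruct (good_column W a L) as [y Hy].
  exists (fun x => (p1 x < a /\ W x) \/ (p1 x = a /\ y (p2 x))).
  intros a' Ha' t Ht. destruct (Nat.eq_dec a' a) as [->|N].
  - apply good_all.
    set (W' := fun x => (p1 x < a /\ W x) \/ (p1 x = a /\ y (p2 x))).
    assert (E : forall x, p1 x < a -> (W x <-> W' x)) by (unfold W'; intuition lia).
    assert (E' : forall i, y i <-> col W' a i).
    { intros i. unfold col, W'. rewrite p1_pair, p2_pair. intuition lia. }
    destruct (Hy t Ht) as [H|H]; [left|right].
    + intros K. apply H. revert K. apply kill_ext; intros; symmetry; auto.
    + intros y'. apply (kill_ext W W' a t y' y'); auto. tauto.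
  - apply good_ext with W; [|apply IH; auto; lia]. intuition lia.
Qed.

Let T (s : nat) : Prop := forall z, z < slen s -> good (sset s) (p1 z) (p2 z).

Let T_pre Y k : T (pre Y k) <-> forall z, z < k -> good Y (p1 z) (p2 z).
Proof.
  unfold T. rewrite slen_pre. split; intros H z Hz; generalize (H z Hz); apply good_ext;
    rewrite pair_p; intros x Hx _; rewrite sset_pre; intuition lia.
Qed.

Let dec_kill X W a t y : dec X Z -> comp X W -> comp X a -> comp X t -> comp X y ->
  dec X (fun n => kill (sset (W n)) (a n) (t n) (sset (y n))).
Proof.
  intros HZ HW Ha Ht Hy. unfold kill.
  apply (dec_bex_le X t (fun n i => exists k, k <= t n /\
    halts (pre (join_cols Z (sset (W n)) (p2 (a n))) k) (p1 (a n)) (pre (sset (y n)) i))); auto.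
  apply (dec_bex_le X (fun z => t (p1 z)) (fun z k =>
    halts (pre (join_cols Z (sset (W (p1 z))) (p2 (a (p1 z)))) k) (p1 (a (p1 z)))
      (pre (sset (y (p1 z))) (p2 z)))).
  { apply (comp_comp X t); cmp. }
  assert (C : forall f, comp X f -> comp X (fun z => f (p1 (p1 z)))).
  { intros f Hf. apply (comp_comp X f); cmp. }
  apply dec_halts; [|apply comp_p1, (C a); auto|].
  - apply (comp_pre X (fun n => join_cols Z (sset (W n)) (p2 (a n))) (fun z => p1 (p1 z)) p2);
      [|cmp|cmp].
    unfold join_cols. apply dec_or; [apply dec_and; [cmp|apply (dec_app X Z); cmp]|].
    apply dec_and; [cmp|]. apply dec_and.
    + apply dec_lt; [cmp|]. apply comp_p2, (comp_comp X a); cmp.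
    + apply dec_sset; [apply (comp_comp X W)|]; cmp.
  - apply comp_pre_sset; [apply (C y); auto|cmp].
Qed.

Let T_dec : dec Z T.
Proof.
  apply (dec_ext Z (fun s => forall z, z < slen s ->
    ~ kill (sset s) (p1 z) (p2 z) (sset (pre (col (sset s) (p1 z)) (p2 z))) \/
    forall v, v < 2 ^ (S (p2 z)) -> kill (sset s) (p1 z) (p2 z) (sset v))).
  - apply (dec_ball Z slen (fun s z => ~ kill (sset s) (p1 z) (p2 z) _ \/
      forall v, v < 2 ^ (S (p2 z)) -> kill (sset s) (p1 z) (p2 z) (sset v))); [cmp|].
    pose proof (dec_oracle Z) as HZ.
    apply dec_or; [apply dec_not|].
    + apply dec_kill; cmp.
      apply (comp_pre Z (fun n => col (sset (p1 n)) (p1 (p2 n))) (fun z => z)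
        (fun z => p2 (p2 z))); cmp. unfold col. cmp.
    + apply (dec_ball Z (fun z => 2 ^ S (p2 (p2 z))) (fun z v =>
        kill (sset (p1 z)) (p1 (p2 z)) (p2 (p2 z)) (sset v))); [cmp|].
      apply dec_kill; cmp.
  - intros s. unfold T, good.
    assert (E : forall z, kill (sset s) (p1 z) (p2 z) (sset (pre (col (sset s) (p1 z)) (p2 z)))
       <-> kill (sset s) (p1 z) (p2 z) (col (sset s) (p1 z))).
    { intros z. split; apply kill_ext; try tauto; intros i Hi; rewrite sset_pre; tauto. }
    split; intros H z Hz; generalize (H z Hz); rewrite E; auto.
Qed.

Theorem scott_low : exists W, dec W Z /\ dec (jump Z) (jump W) /\ scott Z W.
Proof.
  destruct (low_basis Z T) as [W [HW HJ]].
  - apply T_dec.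
  - intros Y j k Hjk. rewrite !T_pre. intros H z Hz. apply H; lia.
  - intros k. destruct (good_ex k k) as [Y HY]. exists Y. apply T_pre. intros z Hz.
    pose proof (p1_le z). pose proof (p2_le z). apply HY; lia.
  - assert (S : scott Z W).
    { intros b Bad HB Hex. destruct (re_index _ _ HB) as [e He].
      (* If column [pair e b] were bad, stage [i + k] would see both the string and the oracle use;
         goodness would then kill every set, against [Hex]. *)
      exists (pair e b). intros i B.
      rewrite He, univ_halts in B. destruct B as [k Hk].
      specialize (HW (S (pair (pair e b) (i + k)))). rewrite T_pre in HW.
      specialize (HW (pair (pair e b) (i + k)) ltac:(lia)).
      rewrite p1_pair, p2_pair, good_all in HW.
      destruct HW as [H|H].
      - apply H. exists i; split; [lia|]. exists k; split; [lia|].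
        rewrite p1_pair, p2_pair. auto.
      - destruct (Hex (i + k)) as [y Hy]. destruct (H y) as [i' [Hi' [k' [_ K]]]].
        rewrite p1_pair, p2_pair in K. apply (Hy i' Hi'). apply He, univ_halts. eauto. }
    exists W. split; [|auto]. apply PA_dec, scott_PA; auto.
Qed.
End Scott.

(** * Partition regular classes *)

Definition subset (X Y : set) : Prop := forall i, X i -> Y i.

(* The elements of [S] are string codes, read as finite sets. *)
Definition open_class (S : set) (Y : set) : Prop := exists t, S t /\ subset (sset t) Y.

Definition up_closed (V : set -> Prop) : Prop := forall X Y, subset X Y -> V X -> V Y.

Definition part_regular (V : set -> Prop) : Prop := forall X Y : set,
  V X -> V (fun i => X i /\ Y i) \/ V (fun i => X i /\ ~ Y i).

(* The sets that meet every c.e. in [Z] open class containing all [R j], even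
   after restriction to an arbitrary [R k]. *)
Definition core (Z : set) (R : nat -> set) (X : set) : Prop := forall S, re Z S ->
  (forall j, open_class S (R j)) -> forall k, open_class S (fun i => X i /\ R k i).

(** An atom of the Boolean algebra generated by the first [slen c] columns: bit [a] of [c] selects
    column [a] or its complement. *)
Definition cell (W : set) (c : nat) : set :=
  fun i => forall a, a < slen c -> (W (pair a i) <-> sset c a).

(** [level_open] is the field for which lowness is spent: it decides, uniformly in an index,
    questions that are c.e. in the set coding the Scott set. [V] is the class that the sets [R j]
    must not leave, namely the infinite sets or the core one level down. *)
Record level (Z : set) (R : nat -> set) (Q : set) (V : set -> Prop) : Prop := {
  level_set : dec Q (fun z => R (p1 z) (p2 z));
  level_open : forall S : nat -> set, re Z (fun z => S (p1 z) (p2 z)) ->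
    dec Q (fun z => open_class (S (p2 z)) (R (p1 z)));
  level_0 : forall i, R 0 i;
  level_decr : forall j k, j <= k -> subset (R k) (R j);
  level_in : forall j, V (R j);
  level_reg : part_regular (core Z R)
}.

Lemma open_class_up S : up_closed (open_class S).
Proof. intros X Y H [t [St Ht]]. exists t; split; auto. intros i Hi; auto. Qed.

Lemma core_up Z R : up_closed (core Z R).
Proof.
  intros X Y H HX S HS HR k. generalize (HX S HS HR k). apply open_class_up.
  intros i [h1 h2]; auto.
Qed.

Lemma cell_pre W Y k i : cell W (pre Y k) i <-> forall a, a < k -> (W (pair a i) <-> Y a).
Proof.
  unfold cell. rewrite slen_pre. split; intros H a Ha; rewrite (H a Ha), sset_pre; tauto.
Qed.

Lemma dec_cell X W c f : dec X W -> comp X c -> comp X f ->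
  dec X (fun n => cell W (c n) (f n)).
Proof.
  intros HW Hc Hf. apply (dec_app2 X (cell W)); auto. unfold cell.
  apply (dec_ball X (fun z => slen (p1 z))
    (fun z a => W (pair a (p2 z)) <-> sset (p1 z) a)); [cmp|].
  apply dec_iff; [|cmp]. apply (dec_app X W); cmp.
Qed.

Lemma subset_sset_bounded t (Y : set) :
  subset (sset t) Y <-> forall i, i < slen t -> sset t i -> Y i.
Proof. split; intros H i; auto. intros Hi; apply H; auto. apply sset_lt; auto. Qed.

Lemma dec_subset X (Y : nat -> set) t : dec X (fun z => Y (p1 z) (p2 z)) -> comp X t ->
  dec X (fun n => subset (sset (t n)) (Y n)).
Proof.
  intros HY Ht. eapply dec_ext; [|intros n; symmetry; apply subset_sset_bounded].
  apply (dec_ball X (fun n => slen (t n)) (fun n i => sset (t n) i -> Y n i)); [cmp|].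
  apply dec_imp; auto. apply dec_sset; [apply (comp_comp X t)|]; cmp.
Qed.

Lemma re_open_class X (S Y : nat -> set) :
  re X (fun z => S (p1 z) (p2 z)) -> dec X (fun z => Y (p1 z) (p2 z)) ->
  re X (fun n => open_class (S n) (Y n)).
Proof.
  intros HS HY. unfold open_class. apply re_ex. apply re_and; auto.
  apply re_dec. apply (dec_subset X (fun z => Y (p1 z)) p2); [|cmp].
  apply (dec_app2 X Y); cmp.
Qed.

Section Step.
Variables (Z W delta : set).
Let R (j : nat) : set := cell W (pre delta j).
Hypothesis W_scott : scott Z W.

Let R_decr j k : j <= k -> subset (R k) (R j).
Proof.
  intros H i. unfold R. rewrite !cell_pre. intros G a Ha. apply G; lia.
Qed.

(* By compactness, the class of [ramsey S] consists of the sets all of whose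
   2-partitions have a part in the class of [S]. *)
Let ramsey (S : set) (r : nat) : Prop := forall v, v < 2 ^ (slen r) * 2 ->
  exists t, S t /\ (subset (sset t) (fun i => sset r i /\ sset v i) \/
                    subset (sset t) (fun i => sset r i /\ ~ sset v i)).

Let re_ramsey S : re Z S -> re Z (ramsey S).
Proof.
  intros HS. unfold ramsey.
  apply (re_ball Z (fun r => 2 ^ slen r * 2) (fun r v => exists t, S t /\
    (subset (sset t) (fun i => sset r i /\ sset v i) \/
     subset (sset t) (fun i => sset r i /\ ~ sset v i)))); [cmp|].
  apply re_ex. apply re_and; [apply (re_app Z S); cmp|]. apply re_dec.
  apply dec_or;
    [apply (dec_subset Z (fun z i => sset (p1 (p1 z)) i /\ sset (p2 (p1 z)) i) p2)
    |apply (dec_subset Z (fun z i => sset (p1 (p1 z)) i /\ ~ sset (p2 (p1 z)) i) p2)]; cmp.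
Qed.

Let ramsey_use S r (Y : set) : ramsey S r ->
  open_class S (fun i => sset r i /\ Y i) \/ open_class S (fun i => sset r i /\ ~ Y i).
Proof.
  intros H. destruct (H (pre Y (slen r))) as [t [St [Ht|Ht]]].
  - pose proof (pre_bound Y (slen r)). simpl in *. lia.
  - left. exists t; split; auto. intros i Hi. destruct (Ht i Hi) as [h1 h2].
    rewrite sset_pre in h2. tauto.
  - right. exists t; split; auto. intros i Hi. destruct (Ht i Hi) as [h1 h2].
    rewrite sset_pre in h2. split; auto. intros Yi. apply h2. split; auto.
    apply sset_lt; auto.
Qed.

(* If [R j] had a partition with no part in the class of [S], then [W] would
   have such a partition as a column, and a later [R k] would be contained in one part. *)
Let ramsey_all S : re Z S -> (forall j, open_class S (R j)) ->
  forall j, open_class (ramsey S) (R j).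
Proof.
  intros HS HR j. apply NNPP. intros N.
  (* Strings that already fail as partitions of [R j]. In the second clause [i < slen y] keeps
     positions beyond the end of [y] from counting as outside. *)
  set (Bad := fun y => exists t, S t /\
     (subset (sset t) (fun i => R j i /\ sset y i) \/
      subset (sset t) (fun i => (i < slen y /\ R j i) /\ ~ sset y i))).
  destruct (W_scott j Bad) as [a Ha].
  (* [R j] is a cell of the first [j] columns, so [Bad] is c.e. in an oracle that the Scott property
     allows. *)
  - assert (DR : dec (join_cols Z W j) (R j)).
    { apply (dec_ext _ (fun i => forall a, a < j ->
         ((p1 (pair a i) < j /\ W (pair a i)) <-> sset (pre delta j) a))).
      - apply (dec_ball _ (fun _ => j) (fun i a =>
         ((p1 (pair a i) < j /\ W (pair a i)) <-> sset (pre delta j) a))); [cmp|].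
        apply dec_iff; [|cmp].
        apply (dec_app _ (fun z => p1 z < j /\ W z) (fun z => pair (p2 z) (p1 z)));
          [apply join_cols_col|cmp].
      - intros i. unfold R, cell. rewrite slen_pre.
        split; intros H b Hb; specialize (H b Hb); rewrite p1_pair in *; tauto. }
    unfold Bad. apply re_ex. apply re_and.
    + apply (re_app _ S); [|cmp]. apply re_trans with Z; auto. apply join_cols_Z.
    + apply re_dec. apply dec_or;
      [apply (dec_subset _ (fun z i => R j i /\ sset (p1 z) i) p2); [|cmp]
      |apply (dec_subset _ (fun z i => (i < slen (p1 z) /\ R j i) /\ ~ sset (p1 z) i) p2); [|cmp]].
      * apply dec_and; [apply (dec_app _ (R j)); cmp|cmp].
      * apply dec_and; [apply dec_and; [cmp|apply (dec_app _ (R j)); cmp]|cmp].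
  - intros t.
    assert (K : ~ ramsey S (pre (R j) t)).
    { intros K. apply N. exists (pre (R j) t). split; auto.
      intros i Hi. rewrite sset_pre in Hi. tauto. }
    unfold ramsey in K. apply not_all_ex_not in K. destruct K as [v K].
    exists (sset v). intros i Hi [u [Su Hu]]. apply K. intros _. exists u. split; auto.
    destruct Hu as [Hu|Hu]; [left|right]; intros x Hx; destruct (Hu x Hx) as [h1 h2];
      rewrite ?slen_pre, ?sset_pre in *.
    + split; [split; [lia|tauto]|tauto].
    + split; [split; [lia|tauto]|tauto].
  (* [R k] lies inside [R j] and, since [a < k], on one side of column [a]. *)
  - set (k := j + a + 1). destruct (HR k) as [t [St Ht]].
    assert (Sj : subset (R k) (R j)) by (apply R_decr; unfold k; lia).
    apply (Ha (slen t)). exists t. split; auto. rewrite slen_pre.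
    assert (E : forall i, sset t i -> (col W a i <-> delta a)).
    { intros i Hi. apply Ht in Hi. unfold R in Hi. rewrite cell_pre in Hi.
      apply Hi. unfold k; lia. }
    destruct (classic (delta a)) as [h|h]; [left|right]; intros i Hi;
      pose proof (sset_lt _ _ Hi); specialize (E i Hi); rewrite sset_pre;
      specialize (Sj i (Ht i Hi)); tauto.
Qed.

(** Suppose the parts fail through open classes [S0] and [S1]. It is not known which part of a
    partition will be large, so [ramsey] is applied to the class [S] of finite sets lying in both.
    Within [X] and a late [R k] it yields a finite set one of whose parts lies in both classes,
    whichever part that is. *)
Lemma core_regular : part_regular (core Z R).
Proof.
  intros X Y HX. apply NNPP. intros N. apply not_or_and in N. destruct N as [N0 N1].
  unfold core in N0, N1.
  apply not_all_ex_not in N0. destruct N0 as [S0 N0].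
  apply imply_to_and in N0. destruct N0 as [H0 N0].
  apply imply_to_and in N0. destruct N0 as [G0 N0].
  apply not_all_ex_not in N0. destruct N0 as [k0 N0].
  apply not_all_ex_not in N1. destruct N1 as [S1 N1].
  apply imply_to_and in N1. destruct N1 as [H1 N1].
  apply imply_to_and in N1. destruct N1 as [G1 N1].
  apply not_all_ex_not in N1. destruct N1 as [k1 N1].
  set (S := fun t => open_class S0 (sset t) /\ open_class S1 (sset t)).
  assert (HS : re Z S).
  { apply re_and; apply (re_open_class Z (fun _ => _) sset);
      [apply (re_app Z S0)|..|apply (re_app Z S1)|]; cmp. }
  assert (HR : forall j, open_class S (R j)).
  { intros j. destruct (G0 j) as [t0 [St0 Ht0]]. destruct (G1 j) as [t1 [St1 Ht1]].
    set (t := pre (fun i => sset t0 i \/ sset t1 i) (slen t0 + slen t1)).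
    assert (Et : forall i, sset t i <-> sset t0 i \/ sset t1 i).
    { intros i. unfold t. rewrite sset_pre. split; [tauto|].
      intros H; split; auto. destruct H as [H|H]; apply sset_lt in H; lia. }
    exists t. split.
    - split; [exists t0|exists t1]; split; auto; intros i Hi; apply Et; auto.
    - intros i Hi. apply Et in Hi. destruct Hi; auto. }
  destruct (HX (ramsey S) (re_ramsey S HS) (ramsey_all S HS HR) (k0 + k1)) as [r [Hr Sr]].
  assert (D : forall i, R (k0 + k1) i -> R k0 i /\ R k1 i).
  { intros i Hi; split; revert Hi; apply R_decr; lia. }
  destruct (ramsey_use S r Y Hr) as [[t [[A B] Ht]]|[t [[A B] Ht]]].
  - apply N0. revert A. apply open_class_up. intros i Hi. destruct (Ht i Hi) as [K1 K2].
    destruct (Sr i K1) as [K3 K4]. apply D in K4. tauto.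
  - apply N1. revert B. apply open_class_up. intros i Hi. destruct (Ht i Hi) as [K1 K2].
    destruct (Sr i K1) as [K3 K4]. apply D in K4. tauto.
Qed.
End Step.

(** * Existence of a single level *)

Theorem level_exists (Z D Q : set) (V : set -> Prop) :
  dec D (jump Z) -> up_closed V -> V AllSet -> part_regular V ->
  (forall W, dec W Z -> dec D (jump W) -> re D (fun c => ~ V (cell W c))) ->
  PA_over Q D -> exists R, level Z R Q V.
Proof.
  intros DZ Vup V1 Vreg Vre HQ.
  destruct (scott_low Z) as [W [WZ [WJ WS]]].
  assert (DW : dec D (jump W)) by (apply dec_trans with (jump Z); auto).
  assert (QD := PA_dec _ _ HQ).
  assert (QW : dec Q W).
  { apply dec_trans with D; auto. apply dec_trans with (jump W); auto. apply dec_jump. }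
  destruct (PA_path Q D (fun c => ~ V (cell W c)) HQ (Vre W WZ DW)) as [delta [Hd Vd]].
  { intros k.
    (* The class of choices is nonempty because, by partition regularity, splitting a cell by column
       [k] leaves one half in [V]. *)
    assert (G : exists Y, V (cell W (pre Y k))).
    { induction k as [|k [Y IH]].
      - exists AllSet. revert V1. apply Vup. intros i _. apply cell_pre. intros; lia.
      - assert (E : forall (b : Prop) i, cell W (pre Y k) i -> (W (pair k i) <-> b) ->
            cell W (pre (fun i => (i < k /\ Y i) \/ (i = k /\ b)) (S k)) i).
        { intros b i. rewrite !cell_pre. intros H Hb a Ha.
          destruct (Nat.eq_dec a k) as [->|N].
          - rewrite Hb. intuition lia.
          - rewrite H by lia. intuition lia. }
        destruct (Vreg _ (col W k) IH) as [H|H].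
        + exists (fun i => (i < k /\ Y i) \/ (i = k /\ True)). revert H. apply Vup.
          intros i [h1 h2]. apply E; auto. unfold col in h2; tauto.
        + exists (fun i => (i < k /\ Y i) \/ (i = k /\ False)). revert H. apply Vup.
          intros i [h1 h2]. apply E; auto. unfold col in h2; tauto. }
    destruct G as [Y HY]. exists Y. intros i Hi N. apply N. revert HY. apply Vup.
    intros x. rewrite !cell_pre. intros H a Ha. apply H; lia. }
  exists (fun j => cell W (pre delta j)). split.
  - apply dec_cell; [auto|apply comp_pre1; cmp|cmp].
  - intros S HS.
    apply (dec_app2 Q (fun c x => open_class (S x) (cell W c)) (fun z => pre delta (p1 z)) p2);
      [|apply comp_pre1; cmp|cmp].
    apply dec_trans with D; auto. apply dec_trans with (jump W); auto. apply re_dec_jump.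
    apply (re_open_class W (fun z => S (p2 z)) (fun z => cell W (p1 z))).
    + apply (re_app2 W S); [apply re_trans with Z|..]; cmp.
    + apply dec_cell; [apply dec_oracle|cmp|cmp].
  - intros i. apply cell_pre. intros; lia.
  - intros j k H i. rewrite !cell_pre. intros G a Ha. apply G; lia.
  - intros j. apply NNPP, Vd.
  - apply core_regular; auto.
Qed.

Lemma Infinite_up : up_closed Infinite.
Proof. intros X Y H HX m. destruct (HX m) as [k [Hk Xk]]. exists k; auto. Qed.

Lemma Infinite_regular : part_regular Infinite.
Proof.
  intros X Y HX. apply NNPP. intros N. apply not_or_and in N. destruct N as [N0 N1].
  apply not_all_ex_not in N0. destruct N0 as [m0 N0].
  apply not_all_ex_not in N1. destruct N1 as [m1 N1].
  destruct (HX (m0 + m1)) as [k [Hk Xk]]. destruct (classic (Y k)).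
  - apply N0. exists k; split; [lia|auto].
  - apply N1. exists k; split; [lia|auto].
Qed.

(** Finiteness of a cell is [Sigma^0_2(W)], hence c.e. in the jump of [W]. *)
Lemma re_finite_cell D W : dec D (jump W) -> re D (fun c => ~ Infinite (cell W c)).
Proof.
  intros HD. apply (re_ext D (fun c => exists m, forall k, m <= k -> ~ cell W c k)).
  - apply re_ex, re_dec. apply dec_trans with (jump W); auto. apply co_re_dec_jump.
    apply (re_ext W (fun z => exists k, p2 z <= k /\ cell W (p1 z) k)).
    + apply re_ex, re_dec, dec_and; [cmp|]. apply dec_cell; [apply dec_oracle|cmp|cmp].
    + intros z. split.
      * intros [k [H1 H2]] G. apply (G k); auto.
      * intros N. apply not_all_ex_not in N. destruct N as [k N].
        apply imply_to_and in N. destruct N as [N1 N2]. exists k; split; auto.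
        apply NNPP; auto.
  - intros c. split.
    + intros [m H] G. destruct (G m) as [k [H1 H2]]. apply (H k); auto.
    + intros N. apply not_all_ex_not in N. destruct N as [m N]. exists m.
      intros k Hk C. apply N; eauto.
Qed.

Lemma core_iff_univ Z R X : core Z R X <-> forall e,
  (forall j, open_class (univ Z e) (R j)) ->
  forall k, open_class (univ Z e) (fun i => X i /\ R k i).
Proof.
  split; intros H.
  - intros e. apply H. apply (re_app2 Z (univ Z) (fun _ => e)); [apply re_univ|cmp|cmp].
  - intros S HS HR k. destruct (re_index Z S HS) as [e He].
    assert (E : forall Y, open_class S Y <-> open_class (univ Z e) Y).
    { intros Y. split; intros [t [Ht Yt]]; exists t; split; auto; apply He; auto. }
    apply E. apply H. intros j. apply E; auto.
Qed.

(** Leaving the core means that some index has a class containing every [R j] but not the cell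
    restricted to some [R k]. By [level_open] the first condition is [Pi^0_1(Q)], and the second is
    [Pi^0_1(W)]. Both are decidable in [D]. *)
Lemma re_core_cell Z R Q V D W : level Z R Q V -> dec Q Z -> dec D (jump Q) ->
  dec W Q -> dec D (jump W) -> re D (fun c => ~ core Z R (cell W c)).
Proof.
  intros L QZ DQ WQ DW.
  apply (re_ext D (fun c => exists e, exists k, (forall j, open_class (univ Z e) (R j)) /\
    ~ open_class (univ Z e) (fun i => cell W c i /\ R k i))).
  - apply re_ex, re_ex, re_dec, dec_and.
    + apply (dec_app D (fun e => forall j, open_class (univ Z e) (R j))); [|cmp].
      apply dec_trans with (jump Q); auto. apply co_re_dec_jump.
      apply (re_ext Q (fun e => exists j, ~ open_class (univ Z e) (R j))).
      * apply re_ex, re_dec, dec_not.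
        apply (dec_app2 Q (fun j e => open_class (univ Z e) (R j)) p2 p1); [|cmp|cmp].
        apply (level_open _ _ _ _ L (univ Z)). apply re_univ.
      * intros e. split; [intros [j H] G; auto|apply not_all_ex_not].
    + apply dec_not. apply dec_trans with (jump W); auto. apply re_dec_jump.
      apply (re_open_class W (fun z => univ Z (p2 (p1 z)))
        (fun z i => cell W (p1 (p1 z)) i /\ R (p2 z) i)).
      * apply (re_app2 W (univ Z)); [|cmp|cmp]. apply re_trans with Z; [|apply re_univ].
        apply dec_trans with Q; auto.
      * apply dec_and; [apply dec_cell; [apply dec_oracle|cmp|cmp]|].
        apply (dec_app2 W R); [|cmp|cmp]. apply dec_trans with Q; auto.
        apply (level_set _ _ _ _ L).
  - intros c. rewrite core_iff_univ. split.
    + intros [e [k [H1 H2]]] G. apply H2, G; auto.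
    + intros N. apply not_all_ex_not in N. destruct N as [e N]. exists e.
      apply imply_to_and in N. destruct N as [H1 N].
      apply not_all_ex_not in N. destruct N as [k N]. exists k; auto.
Qed.

Lemma core_all Z R : core Z R AllSet.
Proof.
  intros S _ HR k. generalize (HR k). apply open_class_up. intros i Hi; split; [exact I|auto].
Qed.

Lemma core_restrict Z R Q V X k : level Z R Q V -> core Z R X ->
  core Z R (fun i => X i /\ R k i).
Proof.
  intros L H S HS HR k'. generalize (H S HS HR (k + k')). apply open_class_up.
  intros i [h1 h2]. repeat split; auto; revert h2; apply (level_decr _ _ _ _ L); lia.
Qed.

(** Restriction to [R k] is absorbed into the open class: [S'] is c.e. in [Q], which decides [R],
    and it contains every [R' j] because [R' j] lies in the lower core. *)
Lemma core_next Z R Q V R' Q' X : level Z R Q V -> dec Q Z -> level Q R' Q' (core Z R) ->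
  core Q R' X -> core Z R X.
Proof.
  intros L QZ L' H S HS HR k.
  set (S' := fun t => open_class S (fun i => sset t i /\ R k i)).
  destruct (H S') with (k := 0) as [t [St Ht]].
  - apply (re_open_class Q (fun _ => S) (fun t i => sset t i /\ R k i)).
    + apply (re_app Q S); [apply re_trans with Z; auto|cmp].
    + apply dec_and; [cmp|]. apply (dec_app2 Q R); [apply (level_set _ _ _ _ L)|cmp|cmp].
  - intros j. destruct (level_in _ _ _ _ L' j S HS HR k) as [t [St Ht]].
    exists t. split; [exists t; split; auto|]; intros i Hi; destruct (Ht i Hi); auto.
  - revert St. apply open_class_up. intros i [h1 h2]. destruct (Ht i h1). auto.
Qed.

(** Having an element above [m] is an open condition that every [R j] satisfies. *)
Lemma core_infinite Z R Q X : level Z R Q Infinite -> core Z R X -> Infinite X.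
Proof.
  intros L H m.
  destruct (H (fun t => exists i, i < slen t /\ (m <= i /\ sset t i))) with (k := 0)
    as [t [[i [_ [Hi Ti]]] Ht]].
  - apply re_dec. cmp.
  - intros j. destruct (level_in _ _ _ _ L j m) as [i [Hi Ri]].
    exists (pre (R j) (S i)). split.
    + exists i. rewrite slen_pre, sset_pre. auto.
    + intros x Hx. rewrite sset_pre in Hx. tauto.
  - exists i. split; auto. apply Ht; auto.
Qed.

(** * The tower of levels *)

Definition prev_class (Z : nat -> set) (R : nat -> nat -> set) (i : nat) : set -> Prop :=
  match i with
  | 0 => Infinite
  | S i => core (Z i) (R i)
  end.

Record tower (n : nat) (Z : nat -> set) (R : nat -> nat -> set) : Prop := {
  tower_level : forall i, i <= n -> level (Z i) (R i) (Z (S i)) (prev_class Z R i);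
  tower_dec : forall i, i <= n -> dec (Z (S i)) (Z i)
}.

Theorem tower_exists n : forall Q, PA_over Q (jumpn (S n) emptyset) ->
  exists Z R, tower n Z R /\ Z (S n) = Q.
Proof.
  induction n as [|n IH]; intros Q HQ.
  - destruct (level_exists emptyset (jump emptyset) Q Infinite) as [R L]; auto.
    + apply dec_oracle.
    + apply Infinite_up.
    + intros m; exists m; split; [auto|exact I].
    + apply Infinite_regular.
    + intros W _ DW. apply re_finite_cell; auto.
    + exists (fun i => match i with 0 => emptyset | _ => Q end), (fun _ => R).
      split; auto. split; intros i Hi; replace i with 0 by lia; auto. apply dec_empty.
  (* Only the top set is prescribed. The one below it is chosen low, so that the next jump computes
     [jump Q0], as [re_core_cell] demands. *)
  - destruct (scott_low (jumpn (S n) emptyset)) as [Q0 [QD [QJ QS]]].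
    destruct (IH Q0 (scott_PA _ _ QS)) as [Z [R [TW E]]].
    pose proof (tower_level _ _ _ TW n ltac:(auto)) as L. rewrite E in L.
    pose proof (tower_dec _ _ _ TW n ltac:(auto)) as D. rewrite E in D.
    destruct (level_exists Q0 (jumpn (S (S n)) emptyset) Q (core (Z n) (R n))) as [R' L']; auto.
    + apply core_up.
    + apply core_all.
    + apply (level_reg _ _ _ _ L).
    + intros W WQ DW. apply (re_core_cell _ _ Q0 _ _ _ L); auto.
    + set (Z1 := fun i => if i =? S (S n) then Q else Z i).
      set (R1 := fun i => if i =? S n then R' else R i).
      assert (Z1E : forall i, i <= S n -> Z1 i = Z i).
      { intros i Hi. unfold Z1. destruct (Nat.eqb_spec i (S (S n))); auto; lia. }
      assert (Z1Q : Z1 (S (S n)) = Q) by (unfold Z1; rewrite Nat.eqb_refl; auto).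
      assert (R1E : forall i, i <= n -> R1 i = R i).
      { intros i Hi. unfold R1. destruct (Nat.eqb_spec i (S n)); auto; lia. }
      assert (R1Q : R1 (S n) = R') by (unfold R1; rewrite Nat.eqb_refl; auto).
      clearbody Z1 R1. exists Z1, R1. split; auto.
      split; intros i Hi; destruct (Nat.eq_dec i (S n)) as [->|N].
      * simpl prev_class. rewrite Z1Q, R1Q, Z1E, E, Z1E, R1E by lia. auto.
      * pose proof (tower_level _ _ _ TW i ltac:(lia)) as L1.
        rewrite !Z1E, R1E by lia. destruct i as [|i]; [exact L1|].
        simpl prev_class in *. rewrite Z1E, R1E by lia. auto.
      * rewrite Z1Q, Z1E, E by lia.
        apply dec_trans with (jumpn (S (S n)) emptyset); [apply PA_dec; auto|].
        apply dec_trans with (jump Q0); auto. apply dec_jump.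
      * rewrite !Z1E by lia. apply (tower_dec _ _ _ TW); lia.
Qed.

Section Tower.
Variables (n : nat) (Z : nat -> set) (R : nat -> nat -> set).
Hypothesis TW : tower n Z R.

Lemma tower_core_le i j X : i <= j -> j <= n -> core (Z j) (R j) X -> core (Z i) (R i) X.
Proof.
  induction 1 as [|j Hij IH]; intros Hj H; auto. apply IH; [lia|].
  revert H. apply core_next with (V := prev_class Z R j) (Q' := Z (S (S j))).
  - apply (tower_level _ _ _ TW); lia.
  - apply (tower_dec _ _ _ TW); lia.
  - apply (tower_level _ _ _ TW (S j)); lia.
Qed.

Lemma tower_core_infinite i X : i <= n -> core (Z i) (R i) X -> Infinite X.
Proof.
  intros Hi H. apply (tower_core_le 0 i) in H; [|lia|auto].
  apply (core_infinite _ _ _ _ (tower_level _ _ _ TW 0 ltac:(lia)) H).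
Qed.

(** Otherwise the part of [X] outside [R i k] would be in the top core, hence in the core of level
    [i], hence still there after intersection with [R i k]. That intersection is empty, but members
    of a core are infinite. *)
Lemma tower_core_restrict i k X : i <= n -> core (Z n) (R n) X ->
  core (Z n) (R n) (fun x => X x /\ R i k x).
Proof.
  intros Hi H. destruct (level_reg _ _ _ _ (tower_level _ _ _ TW n ltac:(lia)) X (R i k) H)
    as [G|G]; auto. exfalso.
  apply (tower_core_le i n) in G; auto.
  apply (core_restrict _ _ _ _ _ k (tower_level _ _ _ TW i Hi)) in G.
  apply tower_core_infinite in G; auto. destruct (G 0) as [x Hx]. tauto.
Qed.

Lemma tower_core_restrict_all k X : core (Z n) (R n) X ->
  core (Z n) (R n) (fun x => X x /\ forall i, i <= n -> R i k x).
Proof.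
  intros H.
  assert (G : forall m, m <= S n -> core (Z n) (R n) (fun x => X x /\ forall i, i < m -> R i k x)).
  { induction m as [|m IH]; intros Hm.
    - revert H. apply core_up. intros x Hx; split; auto. intros; lia.
    - generalize (tower_core_restrict m k _ ltac:(lia) (IH ltac:(lia))). apply core_up.
      intros x [[h1 h2] h3]. split; auto. intros i Hi.
      destruct (Nat.eq_dec i m) as [->|N]; auto. apply h2; lia. }
  generalize (G (S n) (le_n _)). apply core_up. intros x [h1 h2]. split; auto.
  intros i Hi. apply h2; lia.
Qed.

Lemma tower_dec_le i j : i <= j -> j <= S n -> dec (Z j) (Z i).
Proof.
  induction 1 as [|j Hij IH]; intros Hj; [apply dec_oracle|].
  apply dec_trans with (Z j); [apply (tower_dec _ _ _ TW); lia|apply IH; lia].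
Qed.
End Tower.

(** * Forcing *)

(* [holds B m G] is a [Sigma^0_(m+1)] predicate of [G]; its matrix [B] is
   evaluated on initial segments. *)
Fixpoint holds (B : nat -> nat -> Prop) (m : nat) (G : set) (e : nat) : Prop :=
  match m with
  | 0 => exists k, B (pre G k) e
  | S m => exists x, ~ holds B m G (pair e x)
  end.

Definition extends (Y : set) (p q : nat) : Prop :=
  slen p <= slen q /\ (forall i, i < slen p -> (sset p i <-> sset q i)) /\
  (forall i, i < slen q -> slen p <= i -> sset q i -> Y i).

Lemma extends_refl Y p : extends Y p p.
Proof. split; [auto|]. split; [tauto|intros; lia]. Qed.

Lemma extends_trans Y p q r : extends Y p q -> extends Y q r -> extends Y p r.
Proof.
  intros [H1 [H2 H3]] [K1 [K2 K3]]. split; [lia|]. split.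
  - intros i Hi. rewrite H2 by auto. apply K2; lia.
  - intros i Hi Hpi Si. destruct (lt_dec i (slen q)) as [h|h].
    + apply H3; auto. apply K2; auto.
    + apply K3; auto; lia.
Qed.

Lemma extends_mono (Y Y' : set) p q : subset Y Y' -> extends Y p q -> extends Y' p q.
Proof. intros H [H1 [H2 H3]]. repeat split; auto; apply H2; auto. Qed.

Lemma dec_extends X (Y : nat -> set) p q : dec X (fun z => Y (p1 z) (p2 z)) ->
  comp X p -> comp X q -> dec X (fun n => extends (Y n) (p n) (q n)).
Proof.
  intros HY Hp Hq. unfold extends.
  assert (Hp' : comp X (fun z => p (p1 z))) by (apply (comp_comp X p); cmp).
  assert (Hq' : comp X (fun z => q (p1 z))) by (apply (comp_comp X q); cmp).
  apply dec_and; [cmp|]. apply dec_and.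
  - apply (dec_ball X (fun n => slen (p n)) (fun n i => sset (p n) i <-> sset (q n) i)); cmp.
  - apply (dec_ball X (fun n => slen (q n)) (fun n i => slen (p n) <= i -> sset (q n) i -> Y n i));
      cmp.
Qed.

Section Construction.
Variables (n : nat) (Z : nat -> set) (R : nat -> nat -> set).
Hypothesis TW : tower n Z R.
Variable B : nat -> nat -> Prop.
Hypothesis B_dec : dec emptyset (fun z => B (p1 z) (p2 z)).

(** A forcing relation for stems whose reservoirs are the sets [R m k] alone. Leaving [A] out is
    what keeps [witnessed m] c.e. in [Z m]; the core compensates for it in [decide_ex]. *)
Fixpoint witnessed (m : nat) (p e : nat) : Prop :=
  match m with
  | 0 => exists k, k <= slen p /\ B (pre (sset p) k) e
  | S m => exists x, exists k, ~ open_class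
      (fun t => exists q, extends (sset t) p q /\ witnessed m q (pair e x)) (R m k)
  end.

Let reach (m p e t : nat) : Prop := exists q, extends (sset t) p q /\ witnessed m q e.

(* The condition with stem [p] and reservoirs [R _ k] forces the negation of
   formula [e] of level [m]. *)
Let refutes (m p k e : nat) : Prop := ~ open_class (reach m p e) (R m k).

Let reach_open m p e Y : open_class (reach m p e) Y <->
  exists q, extends Y p q /\ witnessed m q e.
Proof.
  split.
  - intros [t [[q [H1 H2]] Ht]]. exists q; split; auto. revert H1. apply extends_mono; auto.
  - intros [q [H1 H2]]. exists (pre (fun i => slen p <= i /\ sset q i) (slen q)). split.
    + exists q; split; auto. destruct H1 as [K1 [K2 K3]]. split; auto. split; auto.
      intros i Hi Hpi Si. apply sset_pre; auto.
    + intros i Hi. rewrite sset_pre in Hi. apply H1; tauto.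
Qed.

Let re_reach m X : re X (fun z => witnessed m (p1 z) (p2 z)) ->
  re X (fun z => reach m (p1 (p1 z)) (p2 (p1 z)) (p2 z)).
Proof.
  intros H. unfold reach. apply re_ex. apply re_and.
  - apply re_dec. apply (dec_extends X (fun z => sset (p2 (p1 z)))); cmp.
  - apply (re_app2 X (witnessed m)); cmp.
Qed.

Let dec_refutes_step m p k e : m <= n -> re (Z m) (fun z => witnessed m (p1 z) (p2 z)) ->
  comp (Z (S m)) p -> comp (Z (S m)) k -> comp (Z (S m)) e ->
  dec (Z (S m)) (fun z => refutes m (p z) (k z) (e z)).
Proof.
  intros Hm Hre Hp Hk He. apply dec_not.
  pose proof (level_open _ _ _ _ (tower_level _ _ _ TW m Hm)
      (fun x t => reach m (p1 x) (p2 x) t) (re_reach m _ Hre)) as L.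
  eapply dec_ext;
    [apply (dec_app2 _ (fun k x => open_class (fun t => reach m (p1 x) (p2 x) t) (R m k)) k
      (fun z => pair (p z) (e z)) L); cmp|].
  intros z; cbv beta. rewrite p1_pair, p2_pair. reflexivity.
Qed.

(** At a successor the negated open class is decided by [Z (S m)] through [level_open], so only two
    existential quantifiers remain. *)
Let re_witnessed m : m <= n -> re (Z m) (fun z => witnessed m (p1 z) (p2 z)).
Proof.
  induction m as [|m IH]; intros Hm.
  - apply re_dec. simpl.
    apply (dec_bex_le _ (fun z => slen (p1 z)) (fun z k => B (pre (sset (p1 z)) k) (p2 z))); [cmp|].
    apply (dec_app2 _ B); [|cmp|cmp]. apply dec_trans with emptyset; auto. apply dec_empty.
  - simpl. apply re_ex, re_ex, re_dec.
    apply (dec_refutes_step m (fun z => p1 (p1 (p1 z))) p2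
      (fun z => pair (p2 (p1 (p1 z))) (p2 (p1 z)))); [lia|apply IH; lia|cmp|cmp|cmp].
Qed.

Let P := Z (S n).
Variable A : set.
Hypothesis A_dec : dec P A.
Hypothesis A_core : core (Z n) (R n) A.

Let dec_refutes m p k e : m <= n -> comp P p -> comp P k -> comp P e ->
  dec P (fun z => refutes m (p z) (k z) (e z)).
Proof.
  intros Hm Hp Hk He. apply (dec_app3 P (refutes m)); auto.
  apply dec_trans with (Z (S m)); [apply (tower_dec_le _ _ _ TW); lia|].
  apply dec_refutes_step; cmp.
Qed.

Let reservoir (k : nat) : set := fun x => A x /\ forall i, i <= n -> R i k x.

Let reservoir_core k : core (Z n) (R n) (reservoir k).
Proof. apply (tower_core_restrict_all _ _ _ TW); auto. Qed.

Let reservoir_le k k' : k <= k' -> subset (reservoir k') (reservoir k).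
Proof.
  intros Hk x [h1 h2]. split; auto. intros i Hi. generalize (h2 i Hi).
  apply (level_decr _ _ _ _ (tower_level _ _ _ TW i Hi)); auto.
Qed.

Let dec_reservoir : dec P (fun z => reservoir (p1 z) (p2 z)).
Proof.
  apply dec_and; [apply (dec_app P A); cmp|].
  assert (G : forall m, m <= S n -> dec P (fun z => forall i, i < m -> R i (p1 z) (p2 z))).
  { induction m as [|m IH]; intros Hm.
    - apply (dec_ext P (fun _ => True)); [cmp|]. intros z; split; auto. intros; lia.
    - apply (dec_ext P (fun z => (forall i, i < m -> R i (p1 z) (p2 z)) /\ R m (p1 z) (p2 z))).
      + apply dec_and; [apply IH; lia|].
        apply dec_trans with (Z (S m)); [apply (tower_dec_le _ _ _ TW); lia|].
        apply (level_set _ _ _ _ (tower_level _ _ _ TW m ltac:(lia))).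
      + intros z. split.
        * intros [h1 h2] i Hi. destruct (Nat.eq_dec i m) as [->|N]; auto. apply h1; lia.
        * intros h; split; auto. }
  eapply dec_ext; [apply (G (S n)); auto|].
  intros z; cbv beta; split; intros h i Hi; apply h; lia.
Qed.

Let refutes_persist m p k e q k' : m <= n -> extends (reservoir k) p q -> k <= k' ->
  refutes m p k e -> refutes m q k' e.
Proof.
  intros Hm Hq Hk H K. apply H. apply reach_open. apply reach_open in K.
  destruct K as [r [K1 K2]]. exists r; split; auto.
  apply extends_trans with q.
  - revert Hq. apply extends_mono. intros x [_ h]; auto.
  - revert K1. apply extends_mono. apply (level_decr _ _ _ _ (tower_level _ _ _ TW m Hm)); auto.
Qed.

Let affirms (m p k e x : nat) : Prop :=
  match m with
  | 0 => witnessed 0 p e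
  | S m => refutes m p k (pair e x)
  end.

Let decides (m p k e x : nat) : Prop := refutes m p k e \/ affirms m p k e x.

Let dec_decides m p k e x : m <= n -> comp P p -> comp P k -> comp P e -> comp P x ->
  dec P (fun z => decides m (p z) (k z) (e z) (x z)).
Proof.
  intros Hm Hp Hk He Hx. apply dec_or; [apply dec_refutes; auto|].
  destruct m as [|m]; [|apply dec_refutes; cmp; lia].
  apply (dec_app2 P (witnessed 0)); auto. simpl.
  apply (dec_bex_le _ (fun z => slen (p1 z)) (fun z k => B (pre (sset (p1 z)) k) (p2 z))); [cmp|].
  apply (dec_app2 _ B); [|cmp|cmp]. apply dec_trans with emptyset; auto. apply dec_empty.
Qed.

Let decide_ex m p k e : m <= n -> exists q k' x,
  extends (reservoir k) p q /\ k <= k' /\ decides m q k' e x.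
Proof.
  intros Hm.
  assert (Mono : forall m q k0 e, m <= n -> refutes m q k0 e -> refutes m q (k + k0) e).
  { intros m' q k0 e' Hm' H. revert H. apply refutes_persist; auto; [apply extends_refl|lia]. }
  destruct (classic (exists k0, refutes m p k0 e)) as [[k0 H]|N].
  - exists p, (k + k0), 0. split; [apply extends_refl|]. split; [lia|]. left; auto.
  - assert (H : open_class (reach m p e) (fun i => reservoir k i /\ R m 0 i)).
    { apply (tower_core_le _ _ _ TW m n _ Hm (le_n n) (reservoir_core k)).
      - eapply re_ext; [apply (re_app _ _ (fun t => pair (pair p e) t)
          (re_reach m _ (re_witnessed m Hm))); cmp|].
        intros t; cbv beta. rewrite !p1_pair, !p2_pair. reflexivity.
      - intros j. apply NNPP. intros K. apply N. exists j; auto. }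
    apply reach_open in H. destruct H as [q [H1 H2]].
    assert (H1' : extends (reservoir k) p q).
    { revert H1. apply extends_mono. intros i [h _]; auto. }
    destruct m as [|m].
    + exists q, k, 0. split; auto. split; auto. right; auto.
    + destruct H2 as [x [k0 H2]]. exists q, (k + k0), x. split; auto. split; [lia|].
      right. apply (Mono m); auto. lia.
Qed.

(* A state [w] codes the stem [p1 w] and the reservoir index [p1 (p2 w)]; stage
   [s] treats the formula [p2 s] of level [p1 s]. *)
Let step (w s w' : nat) : Prop :=
  extends (reservoir (p1 (p2 w))) (p1 w) (p1 w') /\
  p1 (p2 w) <= p1 (p2 w') /\
  (exists x, x < slen (p1 w') /\ (slen (p1 w) <= x /\ sset (p1 w') x)) /\
  forall m, m < S n -> m = p1 s -> decides m (p1 w') (p1 (p2 w')) (p2 s) (p2 (p2 w')).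

Let step_ex w s : exists w', step w s w'.
Proof.
  set (p := p1 w). set (k := p1 (p2 w)).
  destruct (tower_core_infinite _ _ _ TW n _ (le_n n) (reservoir_core k) (slen p)) as [x [Hx Rx]].
  (* A new element is added before the formula is decided; this makes [G] infinite and the stems
     grow. *)
  set (p' := pre (fun i => sset p i \/ i = x) (S x)).
  assert (H : extends (reservoir k) p p').
  { unfold p'. split; [rewrite slen_pre; lia|]. split.
    - intros i Hi. rewrite sset_pre. split; [intros; split; [lia|auto]|].
      intros [_ [h|h]]; [auto|lia].
    - intros i _ Hi Si. rewrite sset_pre in Si. destruct Si as [_ [h| ->]]; auto.
      apply sset_lt in h; lia. }
  assert (Hx' : sset p' x) by (apply sset_pre; auto).
  assert (G : exists q k' y, extends (reservoir k) p' q /\ k <= k' /\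
     forall m, m < S n -> m = p1 s -> decides m q k' (p2 s) y).
  { destruct (le_dec (p1 s) n) as [h|h].
    - destruct (decide_ex (p1 s) p' k (p2 s) h) as [q [k' [y [G1 [G2 G3]]]]].
      exists q, k', y. split; auto. split; auto. intros m _ ->; auto.
    - exists p', k, 0. split; [apply extends_refl|]. split; auto. intros; lia. }
  destruct G as [q [k' [y [G1 [G2 G3]]]]].
  exists (pair q (pair k' y)). unfold step. rewrite !p2_pair, !p1_pair. fold p k.
  split; [apply extends_trans with p'; auto|]. split; auto. split; auto.
  exists x. destruct G1 as [K1 [K2 K3]]. pose proof (sset_lt _ _ Hx').
  split; [lia|]. split; auto. apply K2; auto.
Qed.

Let dec_step : dec P (fun z => step (p1 (p1 z)) (p2 (p1 z)) (p2 z)).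
Proof.
  unfold step. apply dec_and; [|apply dec_and; [cmp|apply dec_and; [cmp|]]].
  - apply (dec_extends P (fun z => reservoir (p1 (p2 (p1 (p1 z)))))); [|cmp|cmp].
    apply (dec_app2 P reservoir); cmp.
  (* The programs deciding the levels are not given uniformly in the level, so the finitely many
     cases are assembled by induction on [m]. This is why [step] quantifies over [m] instead of
     using [p1 s] as the level. *)
  - assert (G : forall m, m <= S n -> dec P (fun z => forall i, i < m -> i = p1 (p2 (p1 z)) ->
      decides i (p1 (p2 z)) (p1 (p2 (p2 z))) (p2 (p2 (p1 z))) (p2 (p2 (p2 z))))).
    { induction m as [|m IH]; intros Hm.
      - apply (dec_ext P (fun _ => True)); [cmp|]. intros z; split; auto. intros; lia.
      - apply (dec_ext P (fun z => (forall i, i < m -> i = p1 (p2 (p1 z)) ->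
           decides i (p1 (p2 z)) (p1 (p2 (p2 z))) (p2 (p2 (p1 z))) (p2 (p2 (p2 z)))) /\
           (m = p1 (p2 (p1 z)) ->
           decides m (p1 (p2 z)) (p1 (p2 (p2 z))) (p2 (p2 (p1 z))) (p2 (p2 (p2 z)))))).
        + apply dec_and; [apply IH; lia|]. apply dec_imp; [cmp|].
          apply dec_decides; [lia|cmp|cmp|cmp|cmp].
        + intros z. split.
          * intros [h1 h2] i Hi. destruct (Nat.eq_dec i m) as [->|N]; auto. apply h1; lia.
          * intros h; split; auto. }
    apply (G (S n)); auto.
Qed.

Theorem generic_exists : exists G : set, Infinite G /\ subset G A /\
  dec (Z (S n)) (holds B n G).
Proof.
  destruct (comp_search P (fun ws w' => step (p1 ws) (p2 ws) w') dec_step) as [g [Hg Eg]].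
  { intros ws. apply step_ex. }
  pose (st := fun s => primrec 0 (fun s w => g (pair w s)) s).
  assert (Hst : comp P st).
  { apply (comp_primrec P (fun _ => 0) (fun s => s) (fun _ s w => g (pair w s))); cmp.
    apply (comp_comp P g); cmp. }
  assert (Est : forall s, step (st s) s (st (S s))).
  { intros s. specialize (Eg (pair (st s) s)). rewrite p1_pair, p2_pair in Eg. exact Eg. }
  assert (st0 : st 0 = 0) by reflexivity.
  clearbody st.
  pose (p := fun s => p1 (st s)). pose (k := fun s => p1 (p2 (st s))).
  assert (k_le : forall s s', s <= s' -> k s <= k s').
  { induction 1 as [|s' Hs IH]; auto. destruct (Est s') as [_ [H _]]. unfold k in *; lia. }
  assert (ext : forall s s', s <= s' -> extends (reservoir (k s)) (p s) (p s')).
  { induction 1 as [|s' Hs IH]; [apply extends_refl|].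
    apply extends_trans with (p s'); auto. destruct (Est s') as [H _].
    revert H. apply extends_mono, reservoir_le, k_le; auto. }
  assert (len : forall s, s <= slen (p s)).
  { induction s as [|s IH]; [lia|]. destruct (Est s) as [_ [_ [[x [H1 [H2 _]]] _]]].
    unfold p in *; lia. }
  pose (G := fun x => exists s, sset (p s) x).
  assert (GE : forall s x, x < slen (p s) -> (G x <-> sset (p s) x)).
  { intros s x Hx. split; [|exists s; auto]. intros [s' H].
    destruct (le_ge_dec s s') as [h|h].
    - apply (ext s s' h); auto.
    - apply (ext s' s h); auto. apply sset_lt; auto. }
  assert (pre_G : forall s k, k <= slen (p s) -> pre G k = pre (sset (p s)) k).
  { intros s j Hj. apply pre_ext. intros i Hi. apply GE; lia. }
  assert (dcd : forall m e, m <= n -> exists x, let s := S (pair m e) in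
     decides m (p s) (k s) e x).
  { intros m e Hm. destruct (Est (pair m e)) as [_ [_ [_ H]]].
    rewrite p1_pair, p2_pair in H. exists (p2 (p2 (st (S (pair m e))))). apply H; auto. lia. }
  (* Forcing equals truth. For a refuted formula of level [S m], an instance [x] making it true in
     [G] was decided at some stage: refuting that instance would have witnessed the formula, and
     affirming it contradicts its falsity. *)
  assert (truth : forall m, m <= n ->
    (forall s e x, affirms m (p s) (k s) e x -> holds B m G e) /\
    (forall s e, refutes m (p s) (k s) e -> ~ holds B m G e)).
  { induction m as [|m IH]; intros Hm; split.
    - intros s e x [j [Hj H]]. exists j. rewrite (pre_G s); auto.
    - intros s e H [j K]. apply H. apply reach_open. exists (p (s + j)). split.
      + specialize (ext s (s + j) ltac:(lia)). revert ext. apply extends_mono.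
        intros x [_ h]. apply h; lia.
      + exists j. pose proof (len (s + j)). split; [lia|]. rewrite <- pre_G; auto. lia.
    - intros s e x H. exists x. apply (proj2 (IH ltac:(lia)) s); auto.
    - intros s e H [x K]. destruct (IH ltac:(lia)) as [IH1 IH2].
      destruct (dcd m (pair e x) ltac:(lia)) as [y D].
      set (s' := S (pair m (pair e x))) in D. simpl in D. destruct D as [D|D].
      + apply H. apply reach_open. exists (p (s + s')). split.
        * specialize (ext s (s + s') ltac:(lia)). revert ext. apply extends_mono.
          intros i [_ h]. apply h; lia.
        * exists x, (k (s + s')).
          change (refutes m (p (s + s')) (k (s + s')) (pair e x)).
          apply (refutes_persist m (p s') (k s')); [lia|apply ext; lia|apply k_le; lia|auto].
      + apply K. eapply IH1; eauto. }
  exists G. split; [|split].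
  - intros m. destruct (Est m) as [_ [_ [[x [H1 [H2 H3]]] _]]]. exists x. split.
    + pose proof (len m). unfold p in *; lia.
    + exists (S m); auto.
  - intros x [s H]. destruct (ext 0 s ltac:(lia)) as [_ [_ E]].
    apply (E x (sset_lt _ _ H)); auto. unfold p. rewrite st0. apply Nat.le_0_l.
  (* [P] runs the construction through stage [pair n e], where formula [e] is decided, and checks
     whether it was refuted. *)
  - eapply dec_ext; [apply dec_not, (dec_refutes n (fun e => p (S (pair n e)))
      (fun e => k (S (pair n e))) (fun e => e)); auto|].
    + unfold p. apply comp_p1, (comp_comp P st); cmp.
    + unfold k. apply comp_p1, comp_p2, (comp_comp P st); cmp.
    + cmp.
    + intros e; cbv beta. destruct (truth n (le_n n)) as [T1 T2].
      destruct (dcd n e (le_n n)) as [x D]. simpl in D. split; intros h.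
      * destruct D as [D|D]; [tauto|]. eapply T1; eauto.
      * intros K. apply (T2 _ _ K); auto.
Qed.
End Construction.

(** * Iterated jumps in the arithmetical hierarchy *)

(** The matrix must be independent of [G], because the construction takes it as input and produces
    [G] afterwards. *)
Definition sigma (m : nat) (S : set -> nat -> Prop) : Prop :=
  exists B, dec emptyset (fun z => B (p1 z) (p2 z)) /\ forall G e, S G e <-> holds B m G e.

Lemma sigma_ext m (S S' : set -> nat -> Prop) :
  sigma m S -> (forall G e, S G e <-> S' G e) -> sigma m S'.
Proof. intros [B [HB E]] H. exists B; split; auto. intros; rewrite <- H; auto. Qed.

Lemma sigma_succ m Q (S : set -> nat -> Prop) :
  sigma m Q -> (forall G e, S G e <-> exists x, ~ Q G (pair e x)) -> sigma (1 + m) S.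
Proof.
  intros [B [HB E]] H. exists B; split; auto. intros G e. rewrite H. simpl.
  split; intros [x K]; exists x; rewrite ?E in *; auto.
Qed.

Lemma sigma_succ_inv m (S : set -> nat -> Prop) : sigma (1 + m) S ->
  exists Q, sigma m Q /\ forall G e, S G e <-> exists x, ~ Q G (pair e x).
Proof.
  intros [B [HB E]]. exists (holds B m). split; auto. exists B; split; auto. tauto.
Qed.

Lemma sigma_0 (B : nat -> nat -> Prop) (S : set -> nat -> Prop) :
  dec emptyset (fun z => B (p1 z) (p2 z)) ->
  (forall G e, S G e <-> exists k, B (pre G k) e) -> sigma 0 S.
Proof. intros; exists B; auto. Qed.

Lemma sigma_dec m R : dec emptyset R -> sigma m (fun _ e => R e).
Proof.
  revert R. induction m as [|m IH]; intros R HR.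
  - apply (sigma_0 (fun _ e => R e)); [apply (dec_app _ R); cmp|].
    intros _ e; split; [exists 0; auto|intros [_ h]; auto].
  - apply (sigma_succ m (fun _ z => ~ R (p1 z))).
    + apply (IH (fun z => ~ R (p1 z))). apply dec_not, (dec_app _ R); cmp.
    + intros _ e. split; [intros h; exists 0|intros [x h]]; rewrite p1_pair in *; auto.
      apply NNPP; auto.
Qed.

Lemma sigma_app m S f : sigma m S -> comp emptyset f -> sigma m (fun G e => S G (f e)).
Proof.
  revert S f. induction m as [|m IH]; intros S f HS Hf.
  - destruct HS as [B [HB E]]. apply (sigma_0 (fun s e => B s (f e))).
    + apply (dec_app2 _ B); cmp. apply (comp_comp _ f); cmp.
    + intros G e. apply E.
  - apply sigma_succ_inv in HS. destruct HS as [Q [HQ E]].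
    apply (sigma_succ m (fun G z => Q G (pair (f (p1 z)) (p2 z)))).
    + apply (IH Q (fun z => pair (f (p1 z)) (p2 z)) HQ).
      apply comp_pair; [apply (comp_comp _ f)|]; cmp.
    + intros G e. rewrite E. split; intros [x h]; exists x; rewrite p1_pair, p2_pair in *; auto.
Qed.

(** Only one case is active for each [e], so the two quantifier prefixes can share their
    variables. *)
Lemma sigma_case m R S S' : dec emptyset R -> sigma m S -> sigma m S' ->
  sigma m (fun G e => (R e /\ S G e) \/ (~ R e /\ S' G e)).
Proof.
  revert R S S'. induction m as [|m IH]; intros R S S' HR HS HS'.
  - destruct HS as [B [HB E]], HS' as [B' [HB' E']].
    apply (sigma_0 (fun s e => (R e /\ B s e) \/ (~ R e /\ B' s e))).
    + apply dec_or; apply dec_and; auto; [|apply dec_not]; apply (dec_app _ R); cmp.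
    + intros G e. rewrite E, E'. simpl. destruct (classic (R e)) as [h|h]; split.
      * intros [[_ [k K]]|K]; [eauto|tauto].
      * intros [k K]. left; split; auto. exists k; tauto.
      * intros [K|[_ [k K]]]; [tauto|eauto].
      * intros [k K]. right; split; auto. exists k; tauto.
  - apply sigma_succ_inv in HS. destruct HS as [Q [HQ E]].
    apply sigma_succ_inv in HS'. destruct HS' as [Q' [HQ' E']].
    apply (sigma_succ m (fun G z => (R (p1 z) /\ Q G z) \/ (~ R (p1 z) /\ Q' G z))).
    + apply (IH (fun z => R (p1 z))); auto. apply (dec_app _ R); cmp.
    + intros G e. rewrite E, E'. destruct (classic (R e)) as [h|h]; split.
      * intros [[_ [k K]]|K]; [|tauto]. exists k. rewrite p1_pair; tauto.
      * intros [k K]. left; split; auto. exists k. rewrite p1_pair in K; tauto.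
      * intros [K|[_ [k K]]]; [tauto|]. exists k. rewrite p1_pair; tauto.
      * intros [k K]. right; split; auto. exists k. rewrite p1_pair in K; tauto.
Qed.

Lemma sigma_guard m R S : dec emptyset R -> sigma m S -> sigma m (fun G e => R e /\ S G e).
Proof.
  intros HR HS. eapply sigma_ext.
  - apply (sigma_case m R S (fun _ _ => False)); auto. apply (sigma_dec m (fun _ => False)); cmp.
  - intros G e; cbv beta; tauto.
Qed.

Lemma sigma_ex m S : sigma m S -> sigma m (fun G e => exists x, S G (pair e x)).
Proof.
  destruct m as [|m]; intros HS.
  - destruct HS as [B [HB E]].
    apply (sigma_0 (fun s e => exists x, x <= slen s /\ exists k, k <= slen s /\
                       B (pre (sset s) k) (pair e x))).
    + apply (dec_bex_le _ (fun z => slen (p1 z)) (fun z x => exists k, k <= slen (p1 z) /\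
                       B (pre (sset (p1 z)) k) (pair (p2 z) x))); [cmp|].
      apply (dec_bex_le _ (fun z => slen (p1 (p1 z)))
         (fun z k => B (pre (sset (p1 (p1 z))) k) (pair (p2 (p1 z)) (p2 z)))); [cmp|].
      apply (dec_app2 _ B); cmp.
    + intros G e. split.
      * intros [x h]. apply E in h. destruct h as [k h]. exists (x + k). rewrite slen_pre.
        exists x; split; [lia|]. exists k; split; [lia|]. rewrite pre_pre by lia. auto.
      * intros [j [x [_ [k [Hk h]]]]]. exists x. apply E. exists k.
        rewrite slen_pre in Hk. rewrite pre_pre in h; auto.
  - apply sigma_succ_inv in HS. destruct HS as [Q [HQ E]].
    apply (sigma_succ m (fun G z => Q G (pair (pair (p1 z) (p1 (p2 z))) (p2 (p2 z))))).
    + apply (sigma_app m Q (fun z => pair (pair (p1 z) (p1 (p2 z))) (p2 (p2 z)))); cmp.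
    + intros G e. split.
      * intros [x h]. apply E in h. destruct h as [y h]. exists (pair x y).
        rewrite ?p1_pair, ?p2_pair, ?p1_pair, ?p2_pair. auto.
      * intros [y h]. exists (p1 y). apply E. exists (p2 y).
        rewrite p1_pair, p2_pair in h. auto.
Qed.

Lemma sigma_not m S : sigma m S -> sigma (1 + m) (fun G e => ~ S G e).
Proof.
  intros HS. apply (sigma_succ m (fun G z => S G (p1 z))).
  - apply (sigma_app m S p1); cmp.
  - intros G e. split; [intros h; exists 0|intros [x h]]; rewrite p1_pair in *; auto.
Qed.

Lemma sigma_lift m S : sigma m S -> sigma (1 + m) S.
Proof.
  revert S. induction m as [|m IH]; intros S HS.
  - destruct HS as [B [HB E]].
    (* The added quantifier is a dummy: the length condition determines the initial segment. *)
    apply (sigma_succ 0 (fun G z => exists k, slen (pre G k) = p2 z /\ ~ B (pre G k) (p1 z))).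
    + apply (sigma_0 (fun s z => slen s = p2 z /\ ~ B s (p1 z))); [|tauto].
      apply dec_and; [cmp|]. apply dec_not, (dec_app2 _ B); cmp.
    + intros G e. rewrite E. simpl. split; intros [k h]; exists k.
      * intros [j [h1 h2]]. rewrite p1_pair, p2_pair, slen_pre in *. subst; auto.
      * apply NNPP. intros N. apply h. exists k. rewrite p1_pair, p2_pair, slen_pre. auto.
  - apply sigma_succ_inv in HS. destruct HS as [Q [HQ E]].
    apply (sigma_succ (1 + m) Q); auto.
Qed.

Lemma finite_choice (b : nat) (Q : nat -> nat -> Prop) :
  (forall i, i < b -> exists x, Q i x) ->
  exists y, forall i, i < b -> Q i (lhd (Nat.iter i ltl y)).
Proof.
  intros H. cut (exists l, length l = b /\ forall i, i < b -> Q i (nth i l 0)).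
  { intros [l [_ Hl]]. exists (lcode l). intros i Hi. rewrite nth_lcode; auto. }
  induction b as [|b IH]; [exists []; split; auto; intros; lia|].
  destruct IH as [l [Ll Hl]]; [auto|]. destruct (H b) as [x Hx]; [auto|].
  exists (l ++ [x]). rewrite length_app. split; [simpl; lia|]. intros i Hi.
  destruct (Nat.eq_dec i b) as [->|N].
  - rewrite app_nth2, Ll, Nat.sub_diag by lia. auto.
  - rewrite app_nth1 by lia. apply Hl; lia.
Qed.

(** At a successor level finitely many witnesses are packed into one list code, and a bounded
    existential quantifier remains under the negation. *)
Lemma sigma_ball m S b : sigma m S -> comp emptyset b ->
  sigma m (fun G e => forall i, i < b e -> S G (pair e i)).
Proof.
  destruct m as [|m]; intros HS Hb.
  - destruct HS as [B [HB E]].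
    apply (sigma_0 (fun s e => forall i, i < b e -> exists k, k < slen s /\
                       B (pre (sset s) k) (pair e i))).
    + apply (dec_ball _ (fun z => b (p2 z)) (fun z i => exists k, k < slen (p1 z) /\
                       B (pre (sset (p1 z)) k) (pair (p2 z) i)));
        [apply (comp_comp _ b); cmp|].
      apply (dec_bex _ (fun z => slen (p1 (p1 z)))
         (fun z k => B (pre (sset (p1 (p1 z))) k) (pair (p2 (p1 z)) (p2 z)))); [cmp|].
      apply (dec_app2 _ B); cmp.
    + intros G e. split.
      * intros h. destruct (bounded_collection (b e) (fun i k => B (pre G k) (pair e i))) as [K HK].
        { intros i Hi. apply E; auto. }
        exists K. rewrite slen_pre. intros i Hi. destruct (HK i Hi) as [k [Hk h']].
        exists k. split; auto. rewrite pre_pre by lia. auto.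
      * intros [j h] i Hi. apply E. destruct (h i Hi) as [k [Hk h']]. exists k.
        rewrite slen_pre in Hk. rewrite pre_pre in h' by lia. auto.
  - apply sigma_succ_inv in HS. destruct HS as [Q [HQ E]].
    apply (sigma_succ m (fun G z => exists i, p2 (pair z i) < b (p1 (p1 (pair z i))) /\
      Q G (pair (pair (p1 (p1 (pair z i))) (p2 (pair z i)))
             (lhd (Nat.iter (p2 (pair z i)) ltl (p2 (p1 (pair z i)))))))).
    + apply (sigma_ex m (fun G x => p2 x < b (p1 (p1 x)) /\
        Q G (pair (pair (p1 (p1 x)) (p2 x)) (lhd (Nat.iter (p2 x) ltl (p2 (p1 x))))))).
      apply (sigma_guard m (fun x => p2 x < b (p1 (p1 x)))).
      * apply dec_lt; [cmp|apply (comp_comp _ b); cmp].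
      * apply (sigma_app m Q (fun x => pair (pair (p1 (p1 x)) (p2 x))
           (lhd (Nat.iter (p2 x) ltl (p2 (p1 x)))))); auto.
        apply comp_pair; [cmp|]. apply comp_lhd, comp_iter; cmp.
    + intros G e. split.
      * intros h. destruct (finite_choice (b e) (fun i x => ~ Q G (pair (pair e i) x))) as [y Hy].
        { intros i Hi. apply E; auto. }
        exists y. intros [i K]. rewrite !p2_pair, !p1_pair, ?p2_pair, ?p1_pair in K.
        destruct K as [K1 K2]. apply (Hy i); auto.
      * intros [y h] i Hi. apply E. exists (lhd (Nat.iter i ltl y)). intros K. apply h.
        exists i. rewrite !p2_pair, !p1_pair, ?p2_pair, ?p1_pair. auto.
Qed.

(** By the use principle, a jump asks for a string that makes the program halt and agrees with the
    oracle. Agreement with an iterated jump is a bounded conjunction of its positive and negative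
    facts, which is one level higher. *)
Lemma sigma_jumpn n : sigma n (fun G => jumpn (S n) G).
Proof.
  induction n as [|n IH].
  - apply (sigma_0 (fun s e => halts s e e)); [cmp|]. intros G e. apply univ_halts.
  - pose (in_S := fun (G : set) x => (sset (p2 (p1 x)) (p2 x) /\ jumpn (S n) G (p2 x)) \/
       (~ sset (p2 (p1 x)) (p2 x) /\ ~ jumpn (S n) G (p2 x))).
    assert (H1 : sigma (S n) in_S).
    { apply (sigma_case (S n) (fun x => sset (p2 (p1 x)) (p2 x))
        (fun G x => jumpn (S n) G (p2 x)) (fun G x => ~ jumpn (S n) G (p2 x))); [cmp|..].
      - apply sigma_lift. apply (sigma_app n (fun G => jumpn (S n) G) p2); cmp.
      - apply sigma_not. apply (sigma_app n (fun G => jumpn (S n) G) p2); cmp. }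
    assert (H2 : sigma (S n) (fun G z => halts (p2 z) (p1 z) (p1 z) /\
                   forall i, i < slen (p2 z) -> in_S G (pair z i))).
    { apply (sigma_guard (S n) (fun z => halts (p2 z) (p1 z) (p1 z))); [cmp|].
      apply (sigma_ball (S n) in_S (fun z => slen (p2 z))); cmp. }
    eapply sigma_ext; [apply (sigma_ex _ _ H2)|].
    intros G e. change (jumpn (S (S n)) G e) with (univ (jumpn (S n) G) e e).
    rewrite univ_halts. cbv beta. unfold in_S.
    assert (E : forall s i, p2 (p1 (pair (pair e s) i)) = s /\ p2 (pair (pair e s) i) = i).
    { intros s i. rewrite p1_pair, !p2_pair; auto. }
    split.
    + intros [s [h1 h2]]. rewrite p1_pair, p2_pair in *. exists (slen s).
      replace (pre (jumpn (S n) G) (slen s)) with s; auto.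
      rewrite <- (pre_sset s) at 1. apply pre_ext. intros i Hi. specialize (h2 i Hi).
      destruct (E s i) as [E1 E2]. rewrite E1, E2 in h2. tauto.
    + intros [k h]. exists (pre (jumpn (S n) G) k). rewrite p1_pair, p2_pair. split; auto.
      rewrite slen_pre. intros i Hi.
      destruct (E (pre (jumpn (S n) G) k) i) as [-> ->]. rewrite sset_pre.
      destruct (classic (jumpn (S n) G i)); tauto.
Qed.

Theorem theorem4p14 (n : nat) (A P : set) :
  Treducible A (jumpn (S n) emptyset) ->
  PA_over P (jumpn (S n) emptyset) ->
  exists G : set,
    Infinite G /\
    ((forall x, G x -> A x) \/ (forall x, G x -> ~ A x)) /\
    Treducible (jumpn (S n) G) P.
Proof.
  intros HA HP.
  destruct (tower_exists n P HP) as [Z [R [TW <-]]].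
  assert (DA : dec (Z (S n)) A) by (apply dec_trans with (2 := HA); apply PA_dec; auto).
  destruct (sigma_jumpn n) as [B [HB E]].
  (* The conjunction with [AllSet] is the form in which partition regularity, applied to [AllSet],
     delivers the two halves. *)
  assert (K : forall A', dec (Z (S n)) A' -> core (Z n) (R n) (fun i => AllSet i /\ A' i) ->
    exists G : set, Infinite G /\ subset G A' /\ Treducible (jumpn (S n) G) (Z (S n))).
  { intros A' HA' CA'.
    destruct (generic_exists n Z R TW B HB (fun i => AllSet i /\ A' i)) as [G [H1 [H2 H3]]]; auto.
    - apply dec_and; auto. unfold AllSet. cmp.
    - exists G. split; auto. split; [intros x Hx; apply H2; auto|].
      eapply dec_ext; [apply H3|]. intros e; symmetry; apply E. }
  destruct (level_reg _ _ _ _ (tower_level _ _ _ TW n (le_n n)) AllSet A (core_all _ _)) as [C|C];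
    apply K in C.
  - destruct C as [G [H1 [H2 H3]]]. exists G; auto.
  - auto.
  - destruct C as [G [H1 [H2 H3]]]. exists G; auto.
  - apply dec_not; auto.
Qed.
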